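(* Let $q_1,q_2$ be coprime positive integers, $Q=q_1q_2$, and let $V:\mathbb{Z}^2\to\mathbb{R}$ be $(q_1,q_2)$-periodic. For $m\in\{1,\dots,Q\}$ and $k\in[0,1)^2$ let $\lambda_m(k)$ be the $m$-th smallest eigenvalue of $D_V(k)$. Let $\lambda_*$ be an extremum (the maximum or the minimum value) of $\lambda_m(k)$ over $k\in[0,1)^2$. Then the level set $\{k\in[0,1)^2:\lambda_m(k)=\lambda_*\}$ has cardinality at most $4q_1q_2$.
   Context: $V$ is $(q_1,q_2)$-periodic if $V(n_1,n_2)=V(n_1+q_1,n_2)=V(n_1,n_2+q_2)$ for all $(n_1,n_2)\in\mathbb{Z}^2$. The operator $\Delta+V$ acts on $u:\mathbb{Z}^2\to\mathbb{C}$ by $((\Delta+V)u)(n)=u(n_1+1,n_2)+u(n_1-1,n_2)+u(n_1,n_2+1)+u(n_1,n_2-1)+V(n)u(n)$. For $k=(k_1,k_2)\in\mathbb{R}^2$, $D_V(k)$ is the $Q\times Q$ matrix of $\Delta+V$ acting on the space of functions $u$ satisfying the Floquet–Bloch conditions $u(n_1+q_1,n_2)=e^{2\pi i k_1}u(n)$ and $u(n_1,n_2+q_2)=e^{2\pi ik_2}u(n)$ for all $n\in\mathbb{Z}^2$, written in the coordinates $\{u(n_1,n_2):1\le n_1\le q_1,\ 1\le n_2\le q_2\}$; it is Hermitian since $V$ is real, so its eigenvalues are real and $\lambda_1(k)\le\dots\le\lambda_Q(k)$. *)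

(* Defs.v *)
From HB Require Import structures.
From mathcomp Require Import all_boot all_order all_algebra.
From mathcomp Require Import boolp classical_sets reals trigo.
From mathcomp.real_closed Require Import complex.

Set Implicit Arguments.
Unset Strict Implicit.
Unset Printing Implicit Defensive.

Import Order.TTheory GRing.Theory Num.Theory.
Local Open Scope ring_scope.

Section Floquet.
Variable R : realType.

Definition is_q_periodic (q1 q2 : nat) (V : int -> int -> R) : Prop :=
  forall n1 n2 : int,
    V n1 n2 = V (n1 + q1%:Z) n2 /\ V n1 n2 = V n1 (n2 + q2%:Z).

Definition expi2pi (x : R) : R[i] :=
  Complex (cos (2 * pi * x)) (sin (2 * pi * x)).

(* The index i : 'I_(q1*q2) stands for the site (n1, n2) with
   n1 = i %/ q2 + 1 in {1..q1}, n2 = i %% q2 + 1 in {1..q2}. *)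
Definition site1 (q1 q2 : nat) (i : 'I_(q1 * q2)) : int := ((i %/ q2)%N + 1)%:Z.
Definition site2 (q1 q2 : nat) (i : 'I_(q1 * q2)) : int := ((i %% q2)%N + 1)%:Z.

(* Reduction of an integer p to its representative in {1..q}, p = rep + q * wind *)
Definition rep (q : nat) (p : int) : int := ((p - 1) %% q%:Z)%Z + 1.
Definition wind (q : nat) (p : int) : int := ((p - 1) %/ q%:Z)%Z.

(* Matrix D_V(k) of Delta + V on Floquet-Bloch functions with
   u(n1+q1,n2) = e^{2 pi i k1} u(n), u(n1,n2+q2) = e^{2 pi i k2} u(n),
   in the coordinates u(n1,n2), 1 <= n1 <= q1, 1 <= n2 <= q2.
   Entry (i,j) is the coefficient of u(site j) in ((Delta+V)u)(site i):
   each neighbour p = site i + d is written p = r + (a q1, b q2) with r in the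
   box, so u(p) = e^{2 pi i (a k1 + b k2)} u(r). *)
Definition DV (q1 q2 : nat) (V : int -> int -> R) (k : R * R)
  : 'M[R[i]]_(q1 * q2) :=
  \matrix_(i, j)
    ((\sum_(d <- [:: (1%:Z, 0%:Z); (-1, 0%:Z); (0%:Z, 1%:Z); (0%:Z, -1)])
        let p1 := site1 i + d.1 in
        let p2 := site2 i + d.2 in
        if (rep q1 p1 == site1 j) && (rep q2 p2 == site2 j) then
          expi2pi ((wind q1 p1)%:~R * k.1 + (wind q2 p2)%:~R * k.2)
        else 0)
     + (if i == j then real_complex R (V (site1 i) (site2 i)) else 0)).

Definition sorted_real_spectrum (Q : nat) (M : 'M[R[i]]_Q) (s : seq R) : Prop :=
  [/\ sorted <=%R s, size s = Q &
      char_poly M = \prod_(x <- s) ('X - (real_complex R x)%:P)].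

Definition eigs (q1 q2 : nat) (V : int -> int -> R) (k : R * R) : seq R :=
  xget [::] [set s | sorted_real_spectrum (DV q1 q2 V k) s].

Definition lambda (q1 q2 : nat) (V : int -> int -> R) (m : nat) (k : R * R) : R :=
  nth 0 (eigs q1 q2 V k) m.-1.

Definition in_unit_box (k : R * R) : Prop :=
  (0 <= k.1 < 1) /\ (0 <= k.2 < 1).

End Floquet.

(* Main.v *)
Require Import Defs.
From mathcomp Require Import all_boot all_order all_algebra.
From mathcomp Require Import perm polyXY sesquilinear spectral.
From mathcomp Require Import zify ring lra.
From mathcomp Require Import boolp classical_sets reals topology normedtype trigo.
From mathcomp.real_closed Require Import complex.
Import Order.TTheory GRing.Theory Num.Theory.
Import numFieldNormedType.Exports.
Local Open Scope ring_scope.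

(**
At a level-set point [k] the determinant [det (D_V(k) - lstar)] has a critical
zero in every real direction: if [lstar] is a multiple eigenvalue the corank is
at least 2; if it is simple, the numbers of eigenvalues above and below [lstar]
are locally semicontinuous, so extremality forces the determinant to keep a
constant sign nearby.

Write [e t] for [exp (2 pi i t)] and put [x = e(k1/q1) = u v],
[y = e(k2/q2) = u / v].  After conjugation by the
phases, [(u v)^Q det (D_V - lstar)] becomes a polynomial [P(u, v)] of degree at
most [2 Q] in each variable, and each [k] lifts to [2 Q] common zeros of [P] and
its two partial derivatives.  As [q1] and [q2] are coprime, [P(0, v)] and
[P(u, 0)] are binomials [c0 + c1 T^(2 Q)] with nonzero coefficients, hence
separable.  So the resultant in [v] of [P] and its [v]-derivative does not
vanish at [u = 0]; its degree is at most [2 Q (4 Q - 1)], and it vanishes at [u]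
to at least the order of the number of singular points above [u].  Hence
[2 Q #ks <= 2 Q (4 Q - 1)].
*)

Set Implicit Arguments.
Unset Strict Implicit.
Unset Printing Implicit Defensive.

(** * Multiple points of a plane curve *)

Section Corank.
Variable F : fieldType.

(** Constant row operations, given by the inverse of a column basis of the matrix at [c], make every
    row of [A] beyond the rank vanish at [c]. Each such row contributes a factor ['X - c%:P]. *)
Lemma XsubC_exp_dvd_det n (A : 'M[{poly F}]_n) c r :
  (\rank (map_mx (horner_eval c) A) + r <= n)%N -> ('X - c%:P) ^+ r %| \det A.
Proof.
set A0 := map_mx _ A => le_r.
pose L := col_ebase A0; pose B := map_mx polyC (invmx L) *m A.
pose D := \row_(i < n) (if (i < \rank A0)%N then 1 else 'X - c%:P).
have B0 (i j : 'I_n) : (\rank A0 <= i)%N -> (B i j).[c] = 0.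
  move=> le_i; have -> : (B i j).[c] = (invmx L *m A0) i j.
    rewrite !mxE horner_sum; apply: eq_bigr => k _.
    by rewrite hornerM !mxE hornerC.
  rewrite -[A0 in LHS]mulmx_ebase -/L -mulmxA mulKmx ?col_ebase_unit// !mxE big1// => k _.
  by rewrite mxE ltnNge le_i andbF mul0r.
pose B' := \matrix_(i, j) (B i j %/ D 0 i).
have BE : B = diag_mx D *m B'.
  apply/matrixP => i j; rewrite mul_diag_mx [in RHS]mxE [B' i j]mxE [D 0 i]mxE.
  case: ltnP => [_|le_i]; first by rewrite divp1 mul1r.
  by rewrite mulrC divpK// dvdp_XsubCl; apply/eqP/B0.
have -> : \det A = (\det L)%:P * \det B.
  rewrite det_mulmx mulrA det_map_mx -rmorphM/= -det_mulmx.
  by rewrite mulmxV ?col_ebase_unit// det1 mul1r.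
apply: dvdp_mull; rewrite BE det_mulmx det_diag; apply: dvdp_mulr.
under eq_bigr do rewrite mxE.
rewrite -(big_mkord xpredT (fun i => if (i < \rank A0)%N then 1 else 'X - c%:P)).
rewrite (@big_cat_nat _ _ _ (\rank A0)) ?rank_leq_row//=.
apply: dvdp_mull; rewrite big_nat_cond.
under eq_bigr => i /andP[/andP[/leq_gtF-> _] _] do [].
by rewrite -big_nat_cond prodr_const_nat dvdp_exp2l//; lia.
Qed.

(** The vectors of powers of distinct points are linearly independent, so the kernel of [A] has
    dimension at least [size vs]. *)
Lemma mxrank_vandermonde_ker n (A : 'M[F]_n) (vs : seq F) :
  uniq vs -> (size vs <= n)%N ->
  (forall v, v \in vs -> A *m \col_(j < n) v ^+ j = 0) ->
  (\rank A + size vs <= n)%N.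
Proof.
move=> uvs le_n Av; pose k := size vs.
pose W := \matrix_(j < n, l < k) vs`_l ^+ j.
have AW : A *m W = 0.
  apply/matrixP => i l; have /colP/(_ i) := Av _ (mem_nth 0 (ltn_ord l)).
  by rewrite !mxE => E; rewrite -[RHS]E; apply: eq_bigr => j _; rewrite !mxE.
have rW : \rank W = k.
  rewrite -mxrank_tr; apply/eqP; change (row_free W^T).
  apply/inj_row_free => a aW; apply/rowP => l; rewrite mxE.
  (* [L] vanishes at all the points except the [l]-th, so pairing a linear relation with its
     coefficients isolates the [l]-th coefficient of the relation. *)
  pose L := \prod_(x <- rem vs`_l vs) ('X - x%:P).
  have vl : vs`_l \in vs by rewrite mem_nth.
  have sL : (size L <= n)%N.
    by rewrite size_prod_XsubC size_rem// prednK// lt0n size_eq0; case: (vs) vl.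
  have rootL x : root L x = (x \in vs) && (x != vs`_l).
    by rewrite root_prod_XsubC mem_rem_uniq// inE andbC.
  suff : a 0 l * L.[vs`_l] = 0.
    move=> /eqP; rewrite mulf_eq0 => /orP[/eqP//|]. move=> rl.
    by have := rootL vs`_l; rewrite /root rl eqxx andbF.
  transitivity (\sum_(l' < k) a 0 l' * L.[vs`_l']).
    rewrite (bigD1 l)//= big1 ?addr0// => l' l'l.
    have /rootP-> : root L vs`_l'; last by rewrite mulr0.
    by rewrite rootL mem_nth//= nth_uniq.
  under eq_bigr do rewrite (horner_coef_wide _ sL) mulr_sumr.
  rewrite exchange_big/= big1// => j _.
  have /rowP/(_ j) := aW; rewrite !mxE => E.
  under eq_bigr do rewrite mulrCA.
  rewrite -mulr_sumr (_ : \sum_(_ < k) _ = 0) ?mulr0// -[RHS]E.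
  by apply: eq_bigr => l' _; rewrite !mxE.
have /mulmx0_rank_max : A *m W = 0 by [].
by rewrite rW.
Qed.

(** The multiplicities of the roots add up to at most the degree of [q], which is one less than its
    [size]. *)
Lemma size_lt_dvdp_fst (zs : seq (F * F)) (q : {poly F}) : q != 0 ->
  (forall u, ('X - u%:P) ^+ count (fun z => z.1 == u) zs %| q) ->
  (size zs < size q)%N.
Proof.
move=> q0 dvd.
suff /(dvdp_leq q0) : \prod_(u <- map fst zs) ('X - u%:P) %| q.
  by rewrite size_prod_XsubC size_map.
have {}dvd u : ('X - u%:P) ^+ count_mem u (map fst zs) %| q.
  by have := dvd u; rewrite count_map.
elim: (map fst zs) q q0 dvd => [|u us IH] {}q q0 dvd; first by rewrite big_nil dvd1p.
rewrite big_cons; have /dvdpP[q' qE] : 'X - u%:P %| q.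
  by apply: dvdp_trans (dvd u); rewrite /= eqxx exprS dvdp_mulr.
rewrite qE mulrC dvdp_mul2r ?polyXsubC_eq0//.
have q'0 : q' != 0 by apply: contraNneq q0; rewrite qE => ->; rewrite mul0r.
apply: IH => // x; rewrite -mup_geq//; have := dvd x.
rewrite qE -mup_geq ?mulf_neq0 ?polyXsubC_eq0// mupM ?polyXsubC_eq0//.
by rewrite (@mup_XsubCX _ 1)/= addnC; case: eqP => _ /=; lia.
Qed.
End Corank.

Lemma size_det_leq (R : idomainType) n (A : 'M[{poly R}]_n) d :
  (forall i j, size (A i j) <= d.+1)%N -> (size (\det A) <= (n * d).+1)%N.
Proof.
move=> leA; rewrite /determinant; apply: (leq_trans (size_sum _ _ _)).
apply/bigmax_leqP => s _; apply: (@leq_trans (size (\prod_i A i (s i)))).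
  by case: odd_perm; rewrite ?expr1 ?expr0 ?mulN1r ?size_polyN ?mul1r.
apply: (leq_trans (size_poly_prod_leq _ _)); rewrite cardT size_enum_ord.
rewrite leq_subLR addnS ltnS; apply: (@leq_trans (\sum_(i < n) d.+1)%N).
  by apply: leq_sum.
by rewrite sum_nat_const card_ord; lia.
Qed.

(* The derivative in [u] only serves to bound the number of points above [u] when
   [P(u, -)] vanishes identically. *)
Lemma card_multiple_points (F : numFieldType) (P : {poly {poly F}}) d
    (zs : seq (F * F)) : (0 < d)%N ->
  (size P <= d.+1)%N -> (forall i, size (P`_i)%R <= d.+1)%N ->
  size (map_poly (horner_eval 0) P) = d.+1 ->
  coprimep (map_poly (horner_eval 0) P) (map_poly (horner_eval 0) P)^`() ->
  coprimep P`_0 (P`_0)^`() ->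
  uniq zs ->
  (forall z, z \in zs -> [/\ P.[z.2%:P].[z.1] = 0, P^`().[z.2%:P].[z.1] = 0 &
     (swapXY P)^`().[z.1%:P].[z.2] = 0]) ->
  (size zs <= d * (2 * d - 1))%N.
Proof.
set P0 := map_poly _ P => d0 leP leP' sP0 copP0 copP00 uzs zsP.
have sP : size P = d.+1.
  by apply/eqP; rewrite eqn_leq leP -sP0 size_poly.
have Pd0 : P0`_d != 0.
  by have := lead_coef_eq0 P0; rewrite -size_poly_eq0 lead_coefE sP0 /= => ->.
have Pd : P`_d != 0.
  by apply: contraNneq Pd0; rewrite coef_map/= => ->; rewrite /horner_eval horner0.
have P'd : P^`()`_d.-1 = P`_d *+ d by rewrite coef_deriv prednK.
have sP' : size P^`() = d.
  apply/eqP; rewrite eqn_leq; apply/andP; split.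
    by have := lt_size_deriv (_ : P != 0); rewrite sP ltnS; apply; rewrite -size_poly_eq0 sP.
  rewrite -{1}(prednK d0); apply: contraNT Pd0; rewrite -leqNgt => le.
  move: P'd; rewrite nth_default// => /(congr1 (horner_eval 0))/esym/eqP.
  by rewrite rmorphMn/= rmorph0 mulrn_eq0 coef_map -leqn0 leqNgt d0.
have evalE u : map_poly (horner_eval u) P = (swapXY P).[u%:P] by rewrite horner_swapXY.
pose S := Sylvester_mx P P^`().
(* At [u = 0] the leading coefficients of [P] and of its derivative survive, so the resultant
   specializes to that of [P0] and its derivative, which is nonzero as [P0] is separable. *)
have nz : resultant P P^`() != 0.
  suff: horner_eval 0 (resultant P P^`()) != 0.
    by apply: contraNneq => ->; rewrite rmorph0.
  rewrite map_resultant ?lead_coefE ?sP ?sP'/=.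
  - by rewrite -deriv_map resultant_eq0 -leqNgt (eqP copP0).
  - by have := Pd0; rewrite coef_map.
  - by rewrite P'd rmorphMn/= mulrn_eq0 negb_or -lt0n d0; have := Pd0; rewrite coef_map.
(* The Sylvester matrix has order [2 d - 1] and entries of degree at most [d] in [u], which bounds
   the degree of the resultant by [d (2 d - 1)]. *)
suff : (size zs < size (resultant P P^`()))%N.
  move/leq_trans; have: (size (resultant P P^`()) <= ((d.-1 + d) * d).+1)%N.
    have -> : (d.-1 + d = (size P^`()).-1 + (size P).-1)%N by rewrite sP sP'.
    apply: size_det_leq => i j; rewrite Sylvester_mxE.
    by case: split => k; rewrite ?coef_deriv mulrb; case: ifP => _; rewrite ?size_poly0//;
      apply: leq_trans (leP' _); rewrite -mulr_natl -polyC_natr size_Cmul// pnatr_eq0.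
  by move=> le /(_ _ le); lia.
apply: size_lt_dvdp_fst => // u; apply: XsubC_exp_dvd_det.
pose vs := [seq z.2 | z <- zs & z.1 == u].
have vsP v : v \in vs -> (u, v) \in zs.
  by case/mapP => -[u' v']; rewrite mem_filter/= => /andP[/eqP-> ?] ->.
have -> : count (fun z => z.1 == u) zs = size vs by rewrite size_map size_filter.
have uvs : uniq vs.
  rewrite map_inj_in_uniq ?filter_uniq// => -[u1 v1] [u2 v2].
  by rewrite !mem_filter/= => /andP[/eqP-> _] /andP[/eqP-> _] ->.
have small (D : {poly F}) : D != 0 -> (size D <= d.+1)%N ->
    (forall v, v \in vs -> D.[v] = 0) -> (size vs <= d)%N.
  move=> D0 sD rD; rewrite -ltnS; apply: leq_trans sD.
  by apply: max_poly_roots => //; apply/allP => v /rD/eqP.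
apply: mxrank_vandermonde_ker => //.
  apply: (@leq_trans d); last by rewrite [in X in (_ <= _ + X)%N]sP leq_addl.
  (* At most [d] points lie above [u]: they are roots of [P(u, -)] if that polynomial is nonzero,
     and otherwise of the derivative of [P] in [u], taken at [u]. *)
  have [Pu0|Pu] := eqVneq (swapXY P).[u%:P] 0; last first.
    apply: (small _ Pu); first by rewrite -evalE (leq_trans (size_poly _ _)).
    by move=> v /vsP/zsP[/= + _ _]; rewrite horner2_swapXY.
  have root00 : root P`_0 u.
    have := congr1 (coefp 0) Pu0; rewrite -evalE/= coef_map coef0 => E.
    exact/rootP.
  apply: (small (swapXY P)^`().[u%:P]).
  (* If this derivative vanished too, its value at [v = 0] would make [u] a multiple root of
     [P(-, 0)], against [copP00]. *)
  - apply: contraTneq (coprimep_root copP00 root00) => E; rewrite negbK.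
    rewrite -(horner_coef0 P) -(polyC0 F) -{1}[P]swapXYK horner_swapXY deriv_map.
    by rewrite -horner_swapXY horner2_swapXY E horner0.
  - rewrite horner_polyC; apply: (leq_trans (size_poly _ _)).
    apply/leq_sizeP => j lt_dj; apply/polyP => i; rewrite coef_swapXY coef_deriv coef0.
    by rewrite coefMn coef_swapXY [P`_j]nth_default ?coef0 ?mul0rn// sP.
  - by move=> v /vsP/zsP[].
move=> v /vsP/zsP[/= Pv P'v _]; apply/colP => i; rewrite mxE [RHS]mxE.
(* A row of the Sylvester matrix lists the coefficients of ['X^k * p], with [p] either [P] or its
   derivative; paired with the powers of [v] it gives a value that vanishes at a multiple point. *)
have rowv (p : {poly {poly F}}) (k : nat) N : (size p + k <= N)%N -> p.[v%:P].[u] = 0 ->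
    \sum_(j < N) horner_eval u (p`_(j - k) *+ (k <= j)%N) * v ^+ j = 0.
  move=> le pv; transitivity (map_poly (horner_eval u) ('X^k * p)).[v].
    rewrite (@horner_coef_wide _ N); last first.
      rewrite (leq_trans (size_poly _ _))// (leq_trans (size_polyMleq _ _))//.
      by rewrite size_polyXn addSn addnC.
    apply: eq_bigr => j _; rewrite coef_map coefXnM leqNgt/=.
    by case: ltnP => _; rewrite ?mulr0n ?mulr1n.
  by rewrite -horner_swapXY horner2_swapXY !hornerM pv mulr0.
under eq_bigr do rewrite [map_mx _ _ _ _]mxE [(\col__ _) _ _]mxE Sylvester_mxE.
case: (splitP i) => k _; apply: rowv => //.
- by have := ltn_ord k; move: (nat_of_ord k) => k'; rewrite sP' sP; lia.
- by have := ltn_ord k; move: (nat_of_ord k) => k'; rewrite sP' sP; lia.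
Qed.

(** * Eigenvalues of Hermitian matrices *)

Lemma char_poly_conj (F : comNzRingType) n (P Q A : 'M[F]_n) :
  Q *m P = 1%:M -> char_poly (Q *m A *m P) = char_poly A.
Proof.
move=> QP; rewrite /char_poly; have -> : char_poly_mx (Q *m A *m P) =
    map_mx polyC Q *m char_poly_mx A *m map_mx polyC P.
  rewrite /char_poly_mx mulmxBr mulmxBl -!map_mxM/= mul_mx_scalar -scalemxAl.
  by rewrite -map_mxM QP/= map_mx1 scalemx1.
rewrite !det_mulmx !det_map_mx mulrAC -rmorphM/= -det_mulmx QP det1.
by rewrite polyC1 mul1r.
Qed.

Section Herm.
Local Open Scope sesquilinear_scope.
Variable R : rcfType.
Local Notation C := R[i].
Local Notation "x %:C" := (real_complex R x).

Lemma mxrank_diag_leq (F : fieldType) n (d : 'rV[F]_n) :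
  (\rank (diag_mx d) <= #|[pred i | d 0%R i != 0%R]|)%N.
Proof.
have -> : diag_mx d = \sum_(i | d 0 i != 0) d 0 i *: delta_mx i i.
  rewrite diag_mx_sum_delta [RHS]big_mkcond/=; apply: eq_bigr => i _.
  by case: eqP => //= ->; rewrite scale0r.
rewrite -sum1_card; elim/big_ind2: _ => [|A k B l leA leB|i di].
- by rewrite mxrank0.
- by apply: (leq_trans (mxrank_add _ _)); apply: leq_add.
- by rewrite mxrank_scale_nz// mxrank_delta.
Qed.

Definition real_spectrum n (A : 'M[C]_n) (s : seq R) :=
  char_poly A = \prod_(x <- s) ('X - x%:C%:P).

(** The spectral theorem with a real diagonal. By the last clause every list of roots of the
    characteristic polynomial is a reordering of that diagonal, so eigenvalues can be counted by
    indices. *)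
Lemma hermitian_diagonalization n (A : 'M[C]_n) : A \is hermsymmx ->
  exists P (d : 'rV[R]_n), [/\ P \is unitarymx,
    A = P^t* *m diag_mx (map_mx (real_complex R) d) *m P
    & forall s, real_spectrum A s <-> perm_eq s [seq d 0 i | i <- enum 'I_n]].
Proof.
move=> hA; pose P := spectralmx A.
have uP : P \is unitarymx by apply: spectral_unitarymx.
have /mxOverP rd := hermitian_spectral_diag_real hA.
exists P, (map_mx (@complex.Re R) (spectral_diag A)).
have dE : map_mx (real_complex R) (map_mx (@complex.Re R) (spectral_diag A)) = spectral_diag A.
  by apply/rowP => i; rewrite !mxE RRe_real// rd.
have AE : A = P^t* *m diag_mx (spectral_diag A) *m P.
  have /hermitian_normalmx/orthomx_spectralP := hA; rewrite invmx_unitary//.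
rewrite dE; split => // s.
have cA : char_poly A = \prod_(i < n) ('X - (spectral_diag A 0 i)%:P).
  rewrite [in LHS]AE char_poly_conj; last by rewrite -invmx_unitary// mulVmx ?spectral_unit.
  by rewrite char_poly_trig ?diag_mx_is_trig//; apply: eq_bigr => i _; rewrite mxE eqxx.
have {}cA : char_poly A = \prod_(x <- [seq (spectral_diag A) 0 i | i <- enum 'I_n]) ('X - x%:P).
  by rewrite cA big_map big_enum.
have mE : [seq spectral_diag A 0 i | i <- enum 'I_n] =
    map (real_complex R) [seq (map_mx (@complex.Re R) (spectral_diag A)) 0 i | i <- enum 'I_n].
  by rewrite -[RHS]map_comp; apply: eq_map => i /=; rewrite -[in LHS]dE !mxE.
rewrite /real_spectrum cA mE; split => [E|E].
  rewrite perm_sym; apply/(perm_map_inj (@complexI R))/prod_XsubC_eq.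
  by rewrite E big_map.
by rewrite big_map; apply/perm_big; rewrite perm_sym.
Qed.

Lemma hermitian_form_diag n (P : 'M[C]_n) (d : 'rV[R]_n) (b : 'rV[C]_n) :
  P \is unitarymx ->
  let A := P^t* *m diag_mx (map_mx (real_complex R) d) *m P in
  ((b *m P) *m A *m (b *m P)^t*) 0 0 = \sum_i (d 0 i)%:C * `|b 0 i| ^+ 2.
Proof.
move=> uP A; rewrite trmx_mul map_mxM !mulmxA mulmxtVK// -(mulmxA _ P) (unitarymxP uP) mulmx1.
rewrite mxE; apply: eq_bigr => i _; rewrite mul_mx_diag !mxE normCK; ring.
Qed.

(* A small perturbation cannot push eigenvalues across 0 from either side:
   the form of [A] stays definite on the span of the eigenvectors of [A0] with
   [0 < sigma * x], which therefore misses the complementary eigenspaces of [A]. *)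
Lemma count_sign_semicontinuous (sigma : R) n (A0 : 'M[C]_n) (s0 : seq R) :
  `|sigma| = 1 -> A0 \is hermsymmx -> real_spectrum A0 s0 ->
  exists2 delta : R, 0 < delta & forall A s, A \is hermsymmx -> real_spectrum A s ->
    (forall i j, `|A i j - A0 i j| <= delta%:C) ->
    (count (fun x => (0 < sigma * x)%R) s0 <= count (fun x => 0 < sigma * x)%R s)%N.
Proof.
move=> sig1 hA0 sA0.
have [P0 [d0 [uP0 A0E /(_ s0)[/(_ sA0) ps0 _]]]] := hermitian_diagonalization hA0.
(* The spectral gap above zero; the default [1] of the minimum serves when no [sigma * d0 0 i] is
   positive. *)
have [eps eps0 epsP] : exists2 eps : R, 0 < eps &
    forall i, 0 < sigma * d0 0 i -> eps <= sigma * d0 0 i.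
  exists (\big[Num.min/1]_(i | 0 < sigma * d0 0 i) (sigma * d0 0 i)).
    by elim/big_ind: _ => // x y x0 y0; rewrite lt_min x0.
  by move=> i di; rewrite (bigD1 i)//= ge_min lexx.
(* A perturbation with entries bounded by this number changes the form by at most [n ^ 2] times it
   on unit vectors, which is less than [eps]. *)
exists (eps / (n%:R ^+ 2 + 1)).
  by rewrite divr_gt0// ltr_wpDl// exprn_ge0.
move=> A s hA sA closeA.
have [P [d [uP AE /(_ s)[/(_ sA) ps _]]]] := hermitian_diagonalization hA.
have cntE (D : 'rV[R]_n) t : perm_eq t [seq D 0 i | i <- enum 'I_n] ->
    count (fun x => 0 < sigma * x) t = #|[pred i | 0 < sigma * D 0 i]|.
  by move=> /seq.permP->; rewrite count_map cardE enumT -size_filter.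
rewrite (cntE _ _ ps) (cntE _ _ ps0) leqNgt; apply/negP => lt_card.
pose ind (Q : pred 'I_n) : 'rV[C]_n := \row_i (Q i)%:R.
have rk_ind (Q : pred 'I_n) : (\rank (diag_mx (ind Q)) <= #|Q|)%N.
  apply: leq_trans (mxrank_diag_leq _) _; apply: eq_leq; apply: eq_card => i.
  by rewrite !inE mxE pnatr_eq0 eqb0 negbK.
pose S0 := [pred i | 0 < sigma * d0 0 i]; pose S := [pred i | 0 < sigma * d 0 i].
(* A vector [a] killed by [K] is supported on [S0] in the eigenbasis of [A0] and off [S] in that of
   [A]. If [S] is smaller than [S0], these are fewer than [n] independent conditions, so a nonzero
   [a] exists. *)
pose K := row_mx (diag_mx (ind [predC S0])) (P0 *m P^t* *m diag_mx (ind S)).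
have ltK : (\rank K < n)%N.
  have -> : K = diag_mx (ind [predC S0]) *m row_mx 1%:M 0
      + P0 *m P^t* *m diag_mx (ind S) *m row_mx 0 1%:M.
    by rewrite !mul_mx_row !mulmx1 !mulmx0 add_row_mx addr0 add0r.
  apply: (leq_ltn_trans (mxrank_add _ _)).
  apply: (@leq_ltn_trans (#|[predC S0]| + #|S|)).
    apply: leq_add; first exact: leq_trans (mxrankM_maxl _ _) (rk_ind _).
    by apply: leq_trans (mxrankM_maxl _ _) (leq_trans (mxrankM_maxr _ _) (rk_ind _)).
  by rewrite -[X in (_ < X)%N](card_ord n) -(cardC S0) addnC ltn_add2r.
have [a a0 aK] : exists2 a : 'rV[C]_n, a != 0 & a *m K = 0.
  have : kermx K != 0 by rewrite -mxrank_eq0 mxrank_ker subn_eq0 -ltnNge.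
  by case/rowV0Pn => a /sub_kermxP aK a0; exists a.
move: aK; rewrite mul_mx_row -row_mx0 => /eq_row_mx[aS0 aS].
pose w := a *m P0; pose b := w *m P^t*.
have wE : w = b *m P by rewrite mulmxKtV.
have a_supp i : ~~ (0 < sigma * d0 0 i) -> a 0 i = 0.
  by move=> di; have /rowP/(_ i) := aS0; rewrite mul_mx_diag !mxE/= di mulr1.
have b_supp i : 0 < sigma * d 0 i -> b 0 i = 0.
  move=> di; have /rowP/(_ i) := aS; rewrite !mulmxA mul_mx_diag mxE [ind _ _ _]mxE/= di.
  by rewrite mulr1 => ->; rewrite mxE.
pose N := \sum_i `|a 0 i| ^+ 2.
have N0 : 0 < N.
  rewrite lt_def sumr_ge0 ?andbT//; last by move=> i _; rewrite exprn_ge0.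
  apply: contra_neq a0 => /eqP; rewrite psumr_eq0; last by move=> i _; rewrite exprn_ge0.
  move=> /allP a_0; apply/rowP => i; rewrite mxE.
  by have := a_0 i (mem_index_enum _); rewrite /= expf_eq0/= normr_eq0 => /eqP.
have form0 : eps%:C * N <= sigma%:C * (w *m A0 *m w^t*) 0 0.
  rewrite A0E (hermitian_form_diag d0 a uP0) mulr_sumr /N mulr_sumr; apply: ler_sum => i _.
  rewrite mulrA -rmorphM/=; case: (boolP (0 < sigma * d0 0 i)) => di.
    by rewrite ler_wpM2r ?exprn_ge0// lecR epsP.
  by rewrite (a_supp _ di) normr0 expr0n/= !mulr0.
have form1 : sigma%:C * (w *m A *m w^t*) 0 0 <= 0.
  rewrite wE AE (hermitian_form_diag d b uP) mulr_sumr; apply: sumr_le0 => i _.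
  rewrite mulrA -rmorphM/=; case: (boolP (0 < sigma * d 0 i)) => di.
    by rewrite (b_supp _ di) normr0 expr0n/= !mulr0.
  by rewrite mulr_le0_ge0 ?exprn_ge0// lecR leNgt.
have wN i : `|w 0 i| ^+ 2 <= N.
  have -> : N = \sum_i `|w 0 i| ^+ 2.
    have E (x : 'rV[C]_n) : \sum_i `|x 0 i| ^+ 2 = (x *m x^t*) 0 0.
      by rewrite mxE; apply: eq_bigr => j _; rewrite !mxE normCK.
    by rewrite /N !E /w trmx_mul map_mxM mulmxA mulmxtVK.
  by rewrite (bigD1 i)//= lerDl sumr_ge0// => j _; rewrite exprn_ge0.
clearbody w; have diffB : `|(w *m (A0 - A) *m w^t*) 0 0| <=
    (eps / (n%:R ^+ 2 + 1))%:C * n%:R ^+ 2 * N.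
  rewrite mxE; apply: (le_trans (ler_norm_sum _ _ _)).
  rewrite (_ : _ * N = \sum_(i < n) \sum_(j < n) (eps / (n%:R ^+ 2 + 1))%:C * N); last first.
    by rewrite !sumr_const card_ord -mulrnA -[RHS]mulr_natr natrM mulrAC expr2.
  apply: ler_sum => j _; rewrite !mxE mulr_suml.
  apply: (le_trans (ler_norm_sum _ _ _)); apply: ler_sum => i _.
  rewrite !mxE 2!normrM norm_conjC mulrAC [leRHS]mulrC ler_pM ?mulr_ge0// 1?distrC ?closeA//.
  rewrite -(@ler_pXn2r _ 2) ?nnegrE ?mulr_ge0 ?(ltW N0)// exprMn [N ^+ 2]expr2.
  by rewrite ler_pM ?exprn_ge0.
have : eps%:C * N <= `|(w *m (A0 - A) *m w^t*) 0 0|.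
  have -> : `|(w *m (A0 - A) *m w^t*) 0 0| = `|sigma%:C * (w *m (A0 - A) *m w^t*) 0 0|.
    rewrite normrM (_ : `|sigma%:C| = 1) ?mul1r// normc_def/= expr0n/= addr0 sqrtr_sqr sig1//.
  have diff : eps%:C * N <= sigma%:C * (w *m (A0 - A) *m w^t*) 0 0.
    rewrite mulmxBr mulmxBl mxE [X in _ + X]mxE mulrBr.
    by apply: (le_trans form0); rewrite lerBrDr gerDl.
  by rewrite ger0_norm// (le_trans _ diff)// mulr_ge0 ?(ltW N0)// lecR ltW.
move=> /le_trans/(_ diffB); rewrite ler_pM2r//.
rewrite (_ : _ * n%:R ^+ 2 = (eps / (n%:R ^+ 2 + 1) * n%:R ^+ 2)%:C); last first.
  by rewrite [RHS]rmorphM rmorphXn/= (rmorph_nat (real_complex R)).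
rewrite lecR.
rewrite leNgt mulrAC ltr_pdivrMr ?ltr_wpDl ?exprn_ge0//.
by rewrite mulrDr mulr1 ltrDl eps0.
Qed.
End Herm.

(** * Double roots at band edges *)

Section Expi.
Variable R : realType.
Local Notation C := R[i].
Local Notation "x %:C" := (real_complex R x).
Local Notation e := (@expi2pi R).

Lemma norm_real_complex (r : R) : `|r%:C| = `|r|%:C.
Proof. by rewrite normc_def/= expr0n/= addr0 sqrtr_sqr. Qed.

Lemma norm_imaginary : `|'i%C : C| = 1.
Proof. by rewrite normc_def/= expr0n/= add0r expr1n sqrtr1. Qed.

Lemma expi2pi0 : e 0 = 1.
Proof. by rewrite /expi2pi mulr0 cos0 sin0. Qed.

Lemma expi2piD x y : e (x + y) = e x * e y.
Proof. by rewrite /expi2pi mulrDr cosD sinD; simpc; congr (_ +i* _)%C; ring. Qed.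

Lemma expi2piN x : e (- x) = Num.conj (e x).
Proof. by rewrite /expi2pi mulrN cosN sinN. Qed.

Lemma expi2piNK x : e (- x) * e x = 1.
Proof. by rewrite -expi2piD addNr expi2pi0. Qed.

Lemma expi2pi_neq0 x : e x != 0.
Proof. by apply/eqP => E; have /eqP := expi2piNK x; rewrite E mulr0 eq_sym oner_eq0. Qed.

Lemma expi2piV x : (e x)^-1 = e (- x).
Proof. by apply: (mulIf (expi2pi_neq0 x)); rewrite mulVf ?expi2pi_neq0// expi2piNK. Qed.

Lemma norm_expi2pi x : `|e x| = 1.
Proof. by rewrite normc_def/= cos2Dsin2 sqrtr1. Qed.

Lemma norm_expi2piN_sub1 x : `|e (- x) - 1| = `|e x - 1|.
Proof.
have -> : e (- x) - 1 = Num.conj (e x - 1) by rewrite rmorphB rmorph1 expi2piN.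
by rewrite norm_conjC.
Qed.

Lemma expi2piXn x n : e x ^+ n = e (n%:R * x).
Proof.
elim: n => [|n IH]; first by rewrite mul0r expi2pi0 expr0.
by rewrite exprS IH -expi2piD -natr1; congr e; ring.
Qed.

Lemma expi2pi_int (m : int) : e m%:~R = 1.
Proof.
have en (n : nat) : e n%:R = 1.
  rewrite -[n%:R]mulr1 -expi2piXn (_ : e 1 = 1) ?expr1n// /expi2pi mulr1.
  by rewrite mulr_natl cos2pi sin2pi.
case: (intP m) => [|n|n]; first by rewrite expi2pi0.
  exact: en.
by rewrite mulrNz expi2piN en rmorph1.
Qed.

(** The identity [cos (2 t) = 1 - 2 sin^2 t] reduces the claim to the positivity of the sine
    strictly between [0] and [pi]. *)
Lemma expi2pi_eq1 x : -1 < x < 1 -> e x = 1 -> x = 0.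
Proof.
move=> /andP[xN x1] [cx _]; apply/eqP/negPn/negP => x0.
have : sin (pi * `|x|) = 0 :> R.
  apply/eqP; rewrite -sqrf_eq0.
  suff : 1 - 2 * sin (pi * `|x|) ^+ 2 = 1 :> R by move=> /eqP; rewrite -subr_eq0; lra.
  rewrite -[RHS]cx -[in RHS]cos_norm !normrM (gtr0_norm (pi_gt0 R)) (@ger0_norm _ 2)//.
  rewrite -[in RHS]mulrA [in RHS]mulr_natl cos_mulr2n cos2sin2; ring.
apply/eqP; rewrite gt_eqF// sin_gt0_pi// mulr_gt0 ?pi_gt0 ?normr_gt0//=.
by rewrite gtr_pMr ?pi_gt0// ltr_norml xN.
Qed.

Lemma expi2pi_near1 (eps : R) : 0 < eps ->
  exists2 h, 0 < sin (2 * pi * h) & `|e h - 1| <= eps%:C.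
Proof.
move=> eps0; have half0 : 0 < eps / 2 by rewrite divr_gt0.
have two_pi0 : 0 < 2 * pi :> R by rewrite mulr_gt0 ?pi_gt0.
have : \forall x \near (0 : R), `|cos x - 1| < eps / 2 /\ `|sin x| < eps / 2.
  have /cvgrPdist_lt/(_ _ half0) s0 := @continuous_sin R 0.
  have /cvgrPdist_lt/(_ _ half0) c0 := @continuous_cos R 0.
  apply: filterS2 c0 s0 => x cx sx; split; first by move: cx; rewrite cos0 distrC.
  by move: sx; rewrite sin0 sub0r normrN.
move=> /nbhs_ballP[d /= d0 dP].
(* The cap at [1] keeps [x] below [pi], where the sine is positive. *)
pose x := Num.min (d / 2) 1.
have x0 : 0 < x by rewrite lt_min divr_gt0/=.
have [] : `|cos x - 1| < eps / 2 /\ `|sin x| < eps / 2.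
  apply: dP; rewrite /ball/= sub0r normrN gtr0_norm//.
  by rewrite gt_min ltr_pdivrMr// mulr_natr mulr2n ltrDl d0.
move=> cx sx; exists (x / (2 * pi)); rewrite /expi2pi mulrC divfK ?gt_eqF//.
  rewrite sin_gt0_pi// x0 (@lt_le_trans _ _ 2) ?pi_ge2// (@le_lt_trans _ _ 1) ?ltr1n//.
  by rewrite ge_min lexx orbT.
rewrite [X in `|X|]complexE/= subr0 (le_trans (ler_normD _ _))// normrM norm_imaginary.
rewrite mul1r !norm_real_complex -rmorphD lecR/= [leRHS]splitr.
by rewrite lerD// ltW.
Qed.

(** Divide [q - q(1)] by ['X - 1]; on the unit disc the quotient is bounded by the sum of the norms
    of its coefficients. *)
Lemma poly_lipschitz1 (q : {poly C}) : exists2 M : R, 0 <= M &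
  forall z, `|z| <= 1 -> `|q.[z] - q.[1]| <= M%:C * `|z - 1|.
Proof.
pose r := (q - (q.[1])%:P) %/ ('X - 1%:P).
have qE : q = r * ('X - 1%:P) + (q.[1])%:P.
  rewrite divpK ?subrK// dvdp_XsubCl /root hornerD hornerN hornerC. by rewrite subrr.
pose M := \sum_(i < size r) `|r`_i|.
have M0 : 0 <= M by apply: sumr_ge0.
exists (complex.Re M); first by have := M0; rewrite lecE/= => /andP[].
move=> z z1; rewrite RRe_real ?ger0_real// {1}qE !hornerE addrK normrM ler_wpM2r//.
rewrite horner_coef (le_trans (ler_norm_sum _ _ _))//; apply: ler_sum => i _.
by rewrite normrM normrX ler_piMr// exprn_ile1.
Qed.

(** At a simple root the real function [p] would change sign at [0] like a sine, against the
    constant sign of [c * p]. *)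
Lemma double_root_of_sign n (F : {poly C}) (p : R -> R) (c delta : R) :
  (0 < n)%N -> 0 < delta -> `|c| = 1 ->
  (forall h, F.[e h] = e h ^+ n * (p h)%:C) ->
  (forall h, `|e h - 1| <= delta%:C -> 0 <= c * p h) ->
  F.[1] = 0 -> F^`().[1] = 0.
Proof.
move=> n0 delta0 c1 FE cp F1.
pose G := F %/ ('X - 1%:P).
have FG : F = G * ('X - 1%:P) by rewrite divpK// dvdp_XsubCl; apply/rootP.
have -> : F^`().[1] = G.[1].
  by rewrite FG derivM derivXsubC hornerD !hornerM hornerXsubC subrr mulr0 add0r hornerC mulr1.
set g := G.[1]; apply/eqP/negPn/negP => g0.
(* At the angle [2 h] one has [e (2 h) - 1 = 2 i sin (2 pi h) e h]. This uses up one of the [2 n]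
   factors [e (- h)] of the normalization, and [B h] below carries the other [k]. *)
pose k := (2 * n).-1.
pose q := G \Po 'X^2 - g *: 'X^k.
have q1 : q.[1] = 0 by rewrite hornerD hornerN hornerZ horner_comp !hornerXn !expr1n mulr1 subrr.
have [M M0 Mq] := poly_lipschitz1 q.
pose B h := e (- h) ^+ k * G.[e h ^+ 2].
have BE h : `|B h - g| <= M%:C * `|e h - 1|.
  apply: le_trans (Mq (e h) _); last by rewrite norm_expi2pi.
  rewrite q1 subr0 -[leRHS]mul1r -(expr1n _ k) -(norm_expi2pi (- h)) -normrX -normrM.
  rewrite hornerD hornerN hornerZ horner_comp !hornerXn mulrBr mulrCA -exprMn.
  rewrite expi2piNK expr1n mulr1.
  by rewrite lexx.
have pE h : c%:C * (p (2 * h))%:C = (sin (2 * pi * h))%:C * (2 * c%:C * 'i%C * B h).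
  have -> : (p (2 * h))%:C = e (- h) ^+ (2 * n) * F.[e h ^+ 2].
    by rewrite [e h ^+ 2]expi2piXn FE mulrA -[e (_ * h)]expi2piXn -exprM -exprMn
      expi2piNK expr1n mul1r.
  have eB : e (- h) * (e h ^+ 2 - 1) = 2 * (sin (2 * pi * h))%:C * 'i%C.
    by rewrite mulrBr mulr1 expr2 mulrA expi2piNK mul1r expi2piN -[Num.conj _]/(conjc _) subcJ.
  have -> : e (- h) ^+ (2 * n) = e (- h) ^+ k * e (- h).
    by rewrite -exprSr /k prednK// muln_gt0.
  have -> : F.[e h ^+ 2] = G.[e h ^+ 2] * (e h ^+ 2 - 1) by rewrite FG hornerM hornerXsubC.
  transitivity (c%:C * (e (- h) ^+ k * G.[e h ^+ 2] * (e (- h) * (e h ^+ 2 - 1)))); first by ring.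
  by rewrite eB /B; ring.
have [r r0 gr] : exists2 r : R, 0 < r & `|g| = r%:C.
  exists (complex.Re `|g|); last by rewrite RRe_real ?normr_real.
  by rewrite -ltcR RRe_real ?normr_real// normr_gt0.
have M1 : 0 < 3 * M + 1 by rewrite ltr_wpDl// mulr_ge0.
(* The first bound keeps [e (2 h)] within [delta] of [1]; the second gives [3 M eps < r], which
   contradicts the estimate of [g] reached at the end. *)
pose eps := Num.min (delta / 2) (r / (3 * M + 1)).
have eps0 : 0 < eps by rewrite lt_min !divr_gt0.
have [h sh he] := expi2pi_near1 eps0.
have near2 h' : `|e h' - 1| <= eps%:C -> `|e (2 * h') - 1| <= delta%:C.
  move=> le; rewrite -[2]/(2%:R) -expi2piXn.
  have -> : e h' ^+ 2 - 1 = (e h' - 1) * (e h' + 1) by ring.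
  rewrite normrM (@le_trans _ _ (eps%:C * 2%:R%:C))//; last first.
    by rewrite -rmorphM lecR -ler_pdivlMr// ge_min lexx.
  rewrite ler_pM// rmorph_nat (le_trans (ler_normD _ _))// norm_expi2pi normr1.
  by rewrite -(natrD _ 1 1).
(* Both values tend to [2 c i g] as [h] tends to [0]. *)
have Apos : 0 <= 2 * c%:C * 'i%C * B h.
  rewrite -(@pmulr_rge0 _ (sin (2 * pi * h))%:C) ?ltcR// -pE -rmorphM lecR.
  exact/cp/near2.
have Aneg : 2 * c%:C * 'i%C * B (- h) <= 0.
  rewrite -(@nmulr_rge0 _ (sin (2 * pi * - h))%:C).
    by rewrite -pE -rmorphM lecR; apply/cp/near2; rewrite norm_expi2piN_sub1.
  by rewrite mulrN sinN ltcR oppr_lt0.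
have normA h' : `|2 * c%:C * 'i%C * B h'| = 2 * `|B h'|.
  by rewrite !normrM norm_imaginary norm_real_complex c1 mulr1 mulr1 normr_nat.
have Mg h' : `|e h' - 1| <= eps%:C -> `|B h' - g| <= (M * eps)%:C.
  by move=> le; apply: (le_trans (BE h')); rewrite rmorphM ler_wpM2l// lecR.
(* The values at [h] and [- h] lie on opposite sides of zero, so each is bounded by their distance;
   both being close to [g], this distance is at most [2 M eps]. *)
have Bh : `|B h| <= (2 * (M * eps))%:C.
  have le1 : `|B h| <= `|B h - B (- h)|.
    have two0 : 0 < 2 :> C by rewrite ltr0n.
    rewrite -(ler_pM2l two0) -normA.
    have -> : 2 * `|B h - B (- h)| = `|2 * c%:C * 'i%C * B h - 2 * c%:C * 'i%C * B (- h)|.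
      by rewrite -mulrBr !normrM norm_imaginary norm_real_complex c1 !mulr1 normr_nat.
    rewrite ger0_norm// ger0_norm; first by rewrite lerDl oppr_ge0.
    by rewrite subr_ge0 (le_trans Aneg).
  apply: (le_trans le1); have -> : B h - B (- h) = (B h - g) - (B (- h) - g) by ring.
  rewrite (le_trans (ler_normB _ _))// mulrC mulr_natr mulr2n rmorphD.
  by rewrite lerD// Mg// norm_expi2piN_sub1.
have : `|g| <= (3 * M * eps)%:C.
  have -> : g = B h - (B h - g) by ring.
  rewrite (le_trans (ler_normB _ _))// (_ : 3 * M * eps = 2 * (M * eps) + M * eps); last by ring.
  by rewrite rmorphD lerD// Mg.
rewrite gr lecR leNgt (@le_lt_trans _ _ (3 * M * (r / (3 * M + 1))))//.
  by rewrite ler_wpM2l ?mulr_ge0// ge_min lexx orbT.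
by rewrite mulrCA -[ltRHS]mulr1 ltr_pM2l// ltr_pdivrMr// mul1r ltrDl.
Qed.

End Expi.

(** * Eigenvalue counts and critical zeros of the determinant *)

Section BandEdge.
Local Open Scope sesquilinear_scope.
Variable R : realType.
Local Notation C := R[i].
Local Notation "x %:C" := (real_complex R x).
Local Notation e := (@expi2pi R).

Lemma sorted_le_split (s : seq R) i : sorted <=%R s -> (i < size s)%N ->
  exists s1 s2, [/\ s = s1 ++ s`_i :: s2, size s1 = i,
    all (fun x => x <= s`_i) s1 & all (fun x => s`_i <= x) s2].
Proof.
move=> srt lt_i; exists (take i s), (drop i.+1 s).
have sE : s = take i s ++ s`_i :: drop i.+1 s by rewrite -drop_nth// cat_take_drop.
move: srt; rewrite {1}sE (sorted_pairwise le_trans) pairwise_cat allrel_consr /=.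
move=> /and3P[/andP[le1 _] _ /andP[le2 _]]; split => //.
by rewrite size_takel// ltnW.
Qed.

Lemma count_pos_sorted (s : seq R) i : sorted <=%R s -> (i < size s)%N ->
  s`_i <= 0 -> (count (fun x => (0 < x)%R) s <= size s - i.+1)%N.
Proof.
move=> srt lt_i le0; have [s1 [s2 [sE s1i le1 _]]] := sorted_le_split srt lt_i.
have c1 : count (fun x => 0 < x) s1 = 0%N.
  apply/eqP; rewrite eqn0Ngt -has_count -all_predC; apply: sub_all le1 => x /= lex.
  by rewrite -leNgt (le_trans lex).
rewrite {1 2}sE count_cat size_cat/= c1 s1i ltNge le0 !add0n.
by rewrite (leq_trans (count_size _ _))// addnS subSS addKn.
Qed.

Lemma count_neg_sorted (s : seq R) i : sorted <=%R s -> (i < size s)%N ->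
  0 <= s`_i -> (count (fun x => (x < 0)%R) s <= i)%N.
Proof.
move=> srt lt_i ge0; have [s1 [s2 [sE s1i _ le2]]] := sorted_le_split srt lt_i.
have c2 : count (fun x => x < 0) s2 = 0%N.
  apply/eqP; rewrite eqn0Ngt -has_count -all_predC; apply: sub_all le2 => x /= lex.
  by rewrite -leNgt (le_trans _ lex).
by rewrite sE count_cat/= c2 ltNge ge0 -s1i !addn0 count_size.
Qed.

Lemma count_sign_total (s : seq R) :
  (count (fun x => (0 < x)%R) s + count (fun x => (x < 0)%R) s + count (pred1 0%R) s)%N = size s.
Proof.
elim: s => //= x s <-.
by case: (ltgtP 0 x) => [x0|x0|x0]; rewrite ?(gt_eqF x0) ?(lt_eqF x0) -?x0 ?eqxx /=; lia.
Qed.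

(** Multiply each factor by [sigma], and by [-1] as well when the result is not positive: all
    factors become nonnegative. So a constant count gives the product a constant weak sign. *)
Lemma prod_sign (sigma : R) (s : seq R) :
  0 <= (-1) ^+ (size s - count (fun x => (0 < sigma * x)%R) s) * sigma ^+ size s
        * \prod_(x <- s) x.
Proof.
elim: s => [|x s IH]; first by rewrite big_nil subnn !expr0 !mulr1.
rewrite big_cons /= exprS.
have le_s := count_size (fun x => 0 < sigma * x) s.
case: (ltP 0 (sigma * x)) => [x0|x0]; rewrite ?add1n ?add0n ?subSS ?subSn// ?exprS.
  rewrite [leRHS](_ : _ = (sigma * x) * ((-1) ^+ (size s - count (fun x => (0 < sigma * x)%R) s)
    * sigma ^+ size s * \prod_(x <- s) x)); last by ring.
  by rewrite mulr_ge0// ltW.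
rewrite [leRHS](_ : _ = (- (sigma * x)) * ((-1) ^+ (size s - count (fun x => (0 < sigma * x)%R) s)
    * sigma ^+ size s * \prod_(x <- s) x)); last by ring.
by rewrite mulr_ge0// oppr_ge0.
Qed.

Lemma det_real_spectrum n (A : 'M[C]_n) s : sorted_real_spectrum A s ->
  \det A = (\prod_(x <- s) x)%:C.
Proof.
move=> [_ sn cA]; have := char_poly_det A; rewrite cA.
rewrite -(big_map (real_complex R) xpredT (fun y => 'X - y%:P)) coef0_prod_XsubC size_map sn.
rewrite big_map rmorph_prod => /(congr1 ( *%R ((-1) ^+ n))).
by rewrite !mulrA -expr2 sqrr_sign !mul1r.
Qed.

Lemma mxrank_real_spectrum n (A : 'M[C]_n) s : A \is hermsymmx ->
  sorted_real_spectrum A s -> (\rank A + count (pred1 0%R) s <= n)%N.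
Proof.
move=> hA [_ sn cA].
have [P [d [uP AE /(_ s)[/(_ cA) ps _]]]] := hermitian_diagonalization hA.
have : (\rank A <= #|[pred i | d 0%R i != 0%R]|)%N.
  rewrite AE (leq_trans (mxrankM_maxl _ _))// (leq_trans (mxrankM_maxr _ _))//.
  rewrite (leq_trans (mxrank_diag_leq _))//; apply: eq_leq; apply: eq_card => i.
  by rewrite !inE mxE fmorph_eq0.
move=> le; rewrite (seq.permP ps) count_map.
have -> : count (preim (fun i => d 0 i) (pred1 0)) (enum 'I_n) = #|[pred i | d 0 i == 0]|.
  by rewrite cardE enumT -size_filter.
rewrite -[leqRHS](card_ord n) -(cardC [pred i | d 0 i == 0]) addnC leq_add2l.
by rewrite (leq_trans le)//; apply: eq_leq; apply: eq_card => i; rewrite !inE.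
Qed.

Lemma twisted_sum_hermitian n (B D : 'M[C]_n) h : D \is hermsymmx ->
  e h *: B + e (- h) *: B^t* + D \is hermsymmx.
Proof.
move=> hD; apply/is_hermitianmxP; rewrite expr0 scale1r; apply/matrixP => i j.
have /is_hermitianmxP/matrixP/(_ i j) := hD.
rewrite expr0 scale1r !mxE => ->; rewrite !rmorphD !rmorphM/= -!expi2piN opprK conjCK.
by rewrite [e (- h) * _ + _]addrC.
Qed.

(** On the unit circle [F] is [e h ^+ n] times the determinant of the Hermitian family. A multiple
    zero eigenvalue gives corank at least 2. For a simple one, extremality bounds an eigenvalue
    count from above and semicontinuity bounds it from below, so the determinant keeps its sign near
    [h = 0]. *)
Lemma band_edge_double_root n (B D : 'M[C]_n) (s : R -> seq R) m :
  D \is hermsymmx -> (0 < m <= n)%N ->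
  (forall h, sorted_real_spectrum (e h *: B + e (- h) *: B^t* + D) (s h)) ->
  (s 0)`_m.-1 = 0 ->
  ((forall h, (s h)`_m.-1 <= 0) \/ (forall h, 0 <= (s h)`_m.-1)) ->
  let F := \det ('X^2 *: map_mx polyC B + map_mx polyC (B^t* ) + 'X *: map_mx polyC D) in
  F.[1] = 0 /\ F^`().[1] = 0.
Proof.
move=> hD /andP[m0 mn] sp s0 edge F.
pose H h := e h *: B + e (- h) *: B^t* + D.
have hH h : H h \is hermsymmx by apply: twisted_sum_hermitian.
have MxE h : map_mx (horner_eval (e h)) ('X^2 *: map_mx polyC B + map_mx polyC (B^t* )
    + 'X *: map_mx polyC D) = e h *: H h.
  apply/matrixP => i j; rewrite !mxE/= /horner_eval.
  rewrite !(hornerD, hornerM, hornerXn, hornerX, hornerC) ?expr2 !mulrDr !mulrA.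
  by rewrite [e h * e (- h)]mulrC expi2piNK mul1r.
have FE h : F.[e h] = e h ^+ n * (\prod_(x <- s h) x)%:C.
  by rewrite -(det_real_spectrum (sp h)) -detZ -MxE det_map_mx.
have sz h : size (s h) = n by have [] := sp h.
have srt h : sorted <=%R (s h) by have [] := sp h.
have m1 : (m.-1 < n)%N by rewrite prednK.
have mem0 : 0 \in s 0.
  by have := @mem_nth _ 0 (s 0) m.-1; rewrite s0 sz; apply.
have F1 : F.[1] = 0.
  by rewrite -(expi2pi0 R) FE (big_rem 0) /= ?mul0r ?rmorph0 ?mulr0.
split => //.
have [two|one] := leqP 2 (count (pred1 0) (s 0)).
  have : ('X - 1%:P) ^+ 2 %| F.
    apply: XsubC_exp_dvd_det; rewrite -(expi2pi0 R) MxE expi2pi0 scale1r.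
    by rewrite (leq_trans _ (mxrank_real_spectrum (hH 0) (sp 0)))// leq_add2l.
  case/dvdpP => q ->.
  by rewrite derivM deriv_exp !hornerE subrr expr0n/= !(mulr0, mul0r, addr0, mul0rn).
(* At a maximum one counts positive eigenvalues: at most [n - m] for every [h], and exactly [n - m]
   at [0], where at most [m - 1] are negative and one is zero. At a minimum one counts negative
   eigenvalues, with [m - 1] in place of [n - m]. *)
have [sigma [K [sig1 leK geK]]] : exists sigma : R, exists K, [/\ `|sigma| = 1,
   forall h, (count (fun x => 0 < sigma * x)%R (s h) <= K)%N
   & (K <= count (fun x => 0 < sigma * x)%R (s 0%R))%N].
  have tot := count_sign_total (s 0).
  case: edge => edge.
    exists 1, (n - m)%N; rewrite normr1; split => // [h|].
      rewrite (eq_count (_ : _ =1 (fun x => 0 < x))) => [|x]; last by rewrite mul1r.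
      by rewrite -(prednK m0) -(sz h) count_pos_sorted ?sz.
    rewrite (eq_count (_ : _ =1 (fun x => 0 < x))) => [|x]; last by rewrite mul1r.
    have := @count_neg_sorted (s 0) m.-1 (srt 0); rewrite s0 sz => /(_ m1 (lexx _)).
    by move: tot; rewrite sz; lia.
  exists (-1), m.-1; rewrite normrN1; split => // [h|].
    rewrite (eq_count (_ : _ =1 (fun x => x < 0))) => [|x]; last by rewrite mulN1r oppr_gt0.
    by rewrite count_neg_sorted ?sz.
  rewrite (eq_count (_ : _ =1 (fun x => x < 0))) => [|x]; last by rewrite mulN1r oppr_gt0.
  have := @count_pos_sorted (s 0) m.-1 (srt 0); rewrite s0 sz => /(_ m1 (lexx _)).
  by move: tot; rewrite sz; lia.
have sp' h : real_spectrum (H h) (s h) by have [] := sp h.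
have [delta delta0 dP] := count_sign_semicontinuous sig1 (hH 0) (sp' 0).
have cK h : (forall i j, `|H h i j - H 0 i j| <= delta%:C) ->
    count (fun x => 0 < sigma * x)%R (s h) = K.
  move=> /(dP _ _ (hH h) (sp' h)) le; apply/eqP.
  by rewrite eqn_leq leK (leq_trans geK le).
pose L := \sum_i \sum_j `|B i j|.
have LB i j : `|B i j| <= L.
  rewrite /L (bigD1 i)//= (bigD1 j)//= -addrA lerDl addr_ge0// sumr_ge0// => *.
  by rewrite sumr_ge0.
(* Each entry of the family moves by at most [2 L] times the norm of [e h - 1], since both [B] and
   its adjoint contribute. *)
have [M M0 ML] : exists2 M : R, 0 <= M & 2 * L = M%:C.
  have L0 : 0 <= 2 * L by rewrite mulr_ge0// sumr_ge0// => i _; rewrite sumr_ge0.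
  by exists (complex.Re (2 * L)); rewrite -?lecR RRe_real ?ger0_real.
apply: (@double_root_of_sign _ _ _ (fun h => \prod_(x <- s h) x)
  ((-1) ^+ (n - K) * sigma ^+ n) (delta / (M + 1)) _ _ _ FE) => //.
- exact: leq_trans mn.
- by rewrite divr_gt0// ltr_wpDl.
- by rewrite normrM !normrX normrN1 sig1 !expr1n mulr1.
move=> h he; have <- := cK h; first by rewrite -(sz h) prod_sign.
move=> i j.
have -> : H h i j - H 0 i j = (e h - 1) * B i j + (e (- h) - 1) * (B j i)^*.
  by rewrite !mxE oppr0 expi2pi0; ring.
rewrite (le_trans (ler_normD _ _))// !normrM norm_conjC norm_expi2piN_sub1 -mulrDr.
rewrite (@le_trans _ _ ((delta / (M + 1))%:C * M%:C))//.
  by rewrite ler_pM ?addr_ge0// -ML mulr_natl mulr2n lerD.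
rewrite -rmorphM lecR mulrAC ler_pdivrMr ?ltr_wpDl//.
by rewrite ler_pM2l// lerDl.
Qed.

End BandEdge.

(** * Hopping matrices *)

Lemma dvdzB_eq (q a b c : int) : (q %| a)%Z -> (q %| b)%Z -> c = a - b -> (q %| c)%Z.
Proof. by move=> qa qb ->; rewrite rpredB. Qed.

Section Lattice.
Local Open Scope sesquilinear_scope.
Variable R : realType.
Local Notation C := R[i].
Local Notation e := (@expi2pi R).
Variables q1 q2 : nat.
Hypotheses (q1_gt0 : (0 < q1)%N) (q2_gt0 : (0 < q2)%N).
Local Notation Q := (q1 * q2)%N.
Implicit Types (i j : 'I_Q) (d : int * int) (th k : R * R).

Definition hops d i j :=
  (rep q1 (site1 i + d.1) == site1 j) && (rep q2 (site2 i + d.2) == site2 j).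

(** The part of the Floquet matrix due to the single displacement [d]. At [k = (0, 0)] it is a
    permutation matrix. *)
Definition hop_mx d k : 'M[C]_Q := \matrix_(i, j)
  if hops d i j then
    e ((wind q1 (site1 i + d.1))%:~R * k.1 + (wind q2 (site2 i + d.2))%:~R * k.2)
  else 0.

Lemma rep_wind q p : p = rep q p + wind q p * q%:Z.
Proof. rewrite /rep /wind; have := divz_eq (p - 1) q%:Z; lia. Qed.

Lemma rep_eq q p (a : nat) : (a < q)%N ->
  (rep q p == (a + 1)%N%:Z) = (q%:Z %| p - (a + 1)%N%:Z)%Z.
Proof.
move=> lt_a; rewrite /rep PoszD (inj_eq (addIr _)).
have -> : p - (a%:Z + 1) = p - 1 - a%:Z by lia.
by rewrite -eqz_mod_dvd (@modz_small a%:Z)//; lia.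
Qed.

Lemma hopsE d i j : hops d i j =
  (q1%:Z %| site1 i + d.1 - site1 j)%Z && (q2%:Z %| site2 i + d.2 - site2 j)%Z.
Proof.
rewrite /hops /site1 /site2 !rep_eq//; first by rewrite ltn_mod.
by rewrite ltn_divLR.
Qed.

Lemma hopsN d i j : hops (- d.1, - d.2) i j = hops d j i.
Proof.
rewrite !hopsE/= (_ : site1 i - _ - _ = - (site1 j + d.1 - site1 i)); last by lia.
rewrite (_ : site2 i - _ - _ = - (site2 j + d.2 - site2 i)); last by lia.
by rewrite !rpredN.
Qed.

Lemma site_inj i j : (q1%:Z %| site1 i - site1 j)%Z -> (q2%:Z %| site2 i - site2 j)%Z -> i = j.
Proof.
move=> d1 d2; apply: val_inj => /=; rewrite (divn_eq i q2) (divn_eq j q2).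
have lt1 (l : 'I_Q) : (l %/ q2 < q1)%N by rewrite ltn_divLR.
move: d1 d2; rewrite -!eqz_mod_dvd /site1 /site2 !PoszD !eqz_modDr.
by rewrite !modz_nat !(modn_small (lt1 _)) !modn_mod => /eqP[->] /eqP[->].
Qed.

Lemma hop_target d i : exists j, hops d i j.
Proof.
pose a := `|((site1 i + d.1 - 1) %% q1%:Z)%Z|%N; pose b := `|((site2 i + d.2 - 1) %% q2%:Z)%Z|%N.
have aE : a%:Z = ((site1 i + d.1 - 1) %% q1%:Z)%Z by rewrite gez0_abs// modz_ge0//; lia.
have bE : b%:Z = ((site2 i + d.2 - 1) %% q2%:Z)%Z by rewrite gez0_abs// modz_ge0//; lia.
have a_lt : (a < q1)%N by rewrite -ltz_nat aE ltz_pmod//; lia.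
have b_lt : (b < q2)%N by rewrite -ltz_nat bE ltz_pmod//; lia.
have lt : (a * q2 + b < Q)%N by nia.
have dE : ((a * q2 + b) %/ q2 = a)%N by rewrite divnMDl// divn_small// addn0.
have mE : ((a * q2 + b) %% q2 = b)%N by rewrite modnMDl modn_small.
exists (Ordinal lt); rewrite /hops /rep {2}/site1 {2}/site2 /= dE mE.
by rewrite !PoszD aE bE !eqxx.
Qed.

Lemma hop_mx0N d : hop_mx (- d.1, - d.2) (0, 0) = (hop_mx d (0, 0))^T.
Proof.
by apply/matrixP => i j; rewrite !mxE hopsN /= !mulr0 !addr0.
Qed.

Lemma hop_mx0_real d : (hop_mx d (0, 0))^t* = (hop_mx d (0, 0))^T.
Proof.
apply/matrixP => i j; rewrite !mxE !mulr0 !addr0 expi2pi0.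
by case: ifP; rewrite ?rmorph0 ?rmorph1.
Qed.

Lemma hop_mx0_mul d : hop_mx d (0, 0) *m (hop_mx d (0, 0))^T = 1%:M.
Proof.
apply/matrixP => i j; rewrite !mxE.
have [l il] := hop_target d i.
rewrite (bigD1 l)//= !mxE il !mulr0 !addr0 expi2pi0 mul1r big1 ?addr0 => [|l' l'l].
  have [<-|ij] := eqVneq i j; first by rewrite il.
  case: ifP => // jl; case/eqP: ij; move: il jl; rewrite !hopsE => /andP[i1 i2] /andP[j1 j2].
  apply: site_inj.
    by apply: (dvdzB_eq i1 j1); lia.
  by apply: (dvdzB_eq i2 j2); lia.
rewrite mxE; case: ifP => [il'|]; last by rewrite mul0r.
case/eqP: l'l; move: il il'; rewrite !hopsE => /andP[i1 i2] /andP[j1 j2].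
apply: site_inj.
  by apply: (dvdzB_eq i1 j1); lia.
by apply: (dvdzB_eq i2 j2); lia.
Qed.

Lemma hop_mxD_int d k (m1 m2 : int) : hop_mx d (k.1 + m1%:~R, k.2 + m2%:~R) = hop_mx d k.
Proof.
apply/matrixP => i j; rewrite !mxE; case: ifP => // _ /=.
set w1 := wind _ _; set w2 := wind _ _.
have -> : w1%:~R * (k.1 + m1%:~R) + w2%:~R * (k.2 + m2%:~R) =
    w1%:~R * k.1 + w2%:~R * k.2 + (w1 * m1 + w2 * m2)%:~R :> R.
  by rewrite rmorphD !rmorphM/=; ring.
by rewrite expi2piD expi2pi_int mulr1.
Qed.

(** The gauge transformation by the plane wave of momentum [th], which trades the phases at the
    boundary of the box for a uniform phase on each hop. *)
Definition phase_mx th : 'M[C]_Q :=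
  diag_mx (\row_i e ((site1 i)%:~R * th.1 + (site2 i)%:~R * th.2)).

Lemma phase_mxV th : phase_mx th *m phase_mx (- th.1, - th.2) = 1%:M.
Proof.
apply/matrixP => i j; rewrite mul_diag_mx !mxE; case: eqP => [->|]; last by rewrite mulr0.
rewrite !mulr1n -expi2piD (_ : _ + _ = 0) ?expi2pi0//=; ring.
Qed.

(** A hop from [i] to [j] satisfies [site i + d = site j + winding * period], so its boundary phase
    is the phase of [d] times the quotient of the phases of the two sites. *)
Lemma hop_mx_conj d th : hop_mx d (q1%:R * th.1, q2%:R * th.2) =
  e (d.1%:~R * th.1 + d.2%:~R * th.2) *:
    (phase_mx th *m hop_mx d (0, 0) *m phase_mx (- th.1, - th.2)).
Proof.
apply/matrixP => i j; rewrite mxE [in RHS]mxE mul_mx_diag mxE mul_diag_mx !mxE.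
case: ifP => [/andP[/eqP h1 /eqP h2]|_]; last by rewrite mulr0 mul0r mulr0.
rewrite !mulr0 addr0 expi2pi0 mulr1 -!expi2piD; congr e => /=.
have E1 : (site1 i)%:~R + d.1%:~R = (site1 j)%:~R + (wind q1 (site1 i + d.1))%:~R * q1%:R :> R.
  by rewrite -h1 -intrD [in LHS](rep_wind q1 (site1 i + d.1)) rmorphD rmorphM.
have E2 : (site2 i)%:~R + d.2%:~R = (site2 j)%:~R + (wind q2 (site2 i + d.2))%:~R * q2%:R :> R.
  by rewrite -h2 -intrD [in LHS](rep_wind q2 (site2 i + d.2)) rmorphD rmorphM.
transitivity (((site1 j)%:~R + (wind q1 (site1 i + d.1))%:~R * q1%:R - (site1 j)%:~R) * th.1 +
   ((site2 j)%:~R + (wind q2 (site2 i + d.2))%:~R * q2%:R - (site2 j)%:~R) * th.2); first by ring.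
by rewrite -E1 -E2; ring.
Qed.

Lemma expi2pi_frac_eq1 (q n : nat) : (0 < q)%N -> e (n%:R / q%:R) = 1 -> (q %| n)%N.
Proof.
move=> q0; rewrite {1}(divn_eq n q) natrD natrM mulrDl mulfK ?pnatr_eq0 -?lt0n//.
rewrite expi2piD (expi2pi_int R (n %/ q)%N) mul1r => /expi2pi_eq1 E.
have qR : 0 < q%:R :> R by rewrite ltr0n.
have /eqP : (n %% q)%:R / q%:R = 0 :> R.
  apply: E; rewrite (@lt_le_trans _ _ 0) ?divr_ge0 ?oppr_lt0//=.
  by rewrite ltr_pdivrMr// mul1r ltr_nat ltn_mod.
by rewrite mulf_eq0 invr_eq0 !pnatr_eq0 (gtn_eqF q0) orbF.
Qed.

Lemma coef_comp_scaleX (f : {poly C}) c n : (f \Po (c *: 'X))`_n = f`_n * c ^+ n.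
Proof.
rewrite comp_polyE; under eq_bigr do rewrite exprZn scalerA.
rewrite -(poly_def (size f) (fun l => f`_l * c ^+ l)) coef_poly.
by case: ltnP => // le; rewrite nth_default ?mul0r.
Qed.

Definition is_unit_step (a : int) := (a == 1) || (a == -1).

(** As [a] is [1] or [-1], the number [e (a / q)] is a primitive [q]-th root of unity, and
    invariance multiplies the [n]-th coefficient by its [n]-th power. *)
Lemma dvdn_of_invariant (f : {poly C}) (q : nat) (a : int) n : (0 < q)%N -> is_unit_step a ->
  f \Po (e (a%:~R / q%:R) *: 'X) = f -> f`_n != 0 -> (q %| n)%N.
Proof.
move=> q0 a1 /(congr1 (fun p : {poly C} => p`_n)); rewrite coef_comp_scaleX => fn fn0.
have : e (a%:~R / q%:R) ^+ n = 1.
  by apply: (mulfI fn0); rewrite fn mulr1.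
rewrite expi2piXn; case/orP: a1 => /eqP->; first by rewrite mul1r; apply: expi2pi_frac_eq1.
rewrite rmorphN mulNr mulrN mul1r expi2piN => /(congr1 Num.conj).
by rewrite conjCK rmorph1; apply: expi2pi_frac_eq1.
Qed.

Lemma hop_mx0_det d : \det (hop_mx d (0, 0)) != 0.
Proof.
apply/eqP => E; have := congr1 determinant (hop_mx0_mul d).
by rewrite det_mulmx E mul0r det1 => /eqP; rewrite eq_sym oner_eq0.
Qed.

(** For [th] in the dual lattice the boundary phases are trivial, so the gauge transformation only
    multiplies the hop by a scalar. *)
Lemma hop_mx0_conj d th (m1 m2 : int) :
  q1%:R * th.1 = m1%:~R -> q2%:R * th.2 = m2%:~R -> hop_mx d (0, 0) =
  e (d.1%:~R * th.1 + d.2%:~R * th.2) *: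
    (phase_mx th *m hop_mx d (0, 0) *m phase_mx (- th.1, - th.2)).
Proof.
move=> E1 E2; rewrite -hop_mx_conj E1 E2.
by rewrite -(hop_mxD_int d (0, 0) m1 m2) /= !add0r.
Qed.

Lemma hop_pencil_conj (d d' : int * int) th (m1 m2 : int) (p p' : {poly C}) :
  q1%:R * th.1 = m1%:~R -> q2%:R * th.2 = m2%:~R ->
  \det (p *: map_mx polyC (hop_mx d (0, 0)) + p' *: map_mx polyC (hop_mx d' (0, 0))) =
  \det ((e (d.1%:~R * th.1 + d.2%:~R * th.2) *: p) *: map_mx polyC (hop_mx d (0, 0)) +
        (e (d'.1%:~R * th.1 + d'.2%:~R * th.2) *: p') *: map_mx polyC (hop_mx d' (0, 0))).
Proof.
move=> E1 E2.
rewrite {1}(hop_mx0_conj d E1 E2) {1}(hop_mx0_conj d' E1 E2).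
set w := e _; set w' := e _; set A := hop_mx d _; set B := hop_mx d' _.
pose U := map_mx polyC (phase_mx th); pose U' := map_mx polyC (phase_mx (- th.1, - th.2)).
have -> : p *: map_mx polyC (w *: (phase_mx th *m A *m phase_mx (- th.1, - th.2))) +
    p' *: map_mx polyC (w' *: (phase_mx th *m B *m phase_mx (- th.1, - th.2))) =
    U *m ((w *: p) *: map_mx polyC A + (w' *: p') *: map_mx polyC B) *m U'.
  rewrite mulmxDr mulmxDl -!scalemxAr -!scalemxAl !map_mxZ !map_mxM !scalerA.
  by congr (_ *: _ + _ *: _); rewrite -mul_polyC mulrC.
by rewrite !det_mulmx mulrAC -det_mulmx -map_mxM phase_mxV map_mx1 det1 mul1r.
Qed.

(* Conjugation by phases multiplies the first (second) hop by a [q1]-th ([q2]-th)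
   root of unity without changing the other one, so only exponents divisible by
   both [q1] and [q2] occur. *)
Lemma det_hop_pencil (a b : int) : coprime q1 q2 -> is_unit_step a -> is_unit_step b ->
  exists c0 c1, [/\ c0 != 0, c1 != 0 &
    \det (map_mx polyC (hop_mx (a, 0) (0, 0)) + 'X *: map_mx polyC (hop_mx (0, b) (0, 0))) =
    c0%:P + c1 *: 'X^Q].
Proof.
move=> cop a1 b1; set A := hop_mx _ _; set B := hop_mx _ _.
set f := \det _.
(* Since [B] is a permutation matrix, [f] is a characteristic polynomial up to the factor [\det B];
   hence its degree is exactly [Q]. *)
have fE : f = \det B *: char_poly (- (A *m B^T)).
  have BB : B^T *m B = 1%:M by apply: mulmx1C; apply: hop_mx0_mul.
  rewrite -mul_polyC -det_map_mx mulrC /char_poly -det_mulmx /char_poly_mx.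
  congr (\det _); rewrite map_mxN opprK mulmxDl -map_mxM -mulmxA BB mulmx1.
  by rewrite mul_scalar_mx addrC.
have sf : size f = Q.+1 by rewrite fE size_scale ?hop_mx0_det// size_char_poly.
have qR q : (0 < q)%N -> q%:R != 0 :> R by move=> q0; rewrite pnatr_eq0 -lt0n.
have compE r : f \Po r = \det (1 *: map_mx polyC A + r *: map_mx polyC B).
  rewrite -[f \Po r]/(comp_poly r f) -det_map_mx; congr (\det _).
  by apply/matrixP => i j; rewrite !mxE/= mul1r comp_polyD comp_polyM !comp_polyC comp_polyX.
have fX : f = \det (1 *: map_mx polyC A + 'X *: map_mx polyC B) by rewrite scale1r.
have dq1 n : f`_n != 0 -> (q1 %| n)%N.
  apply: (dvdn_of_invariant q1_gt0 a1); rewrite compE.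
  (* Rotating ['X] by [w = e (a / q1)] twists the second hop and the gauge transformation twists the
     first, so [w] comes out of the determinant as [w ^+ Q], which is [1]. *)
  rewrite (@hop_pencil_conj _ _ (q1%:R^-1, 0) 1 0) ?mulr0 ?mulfV ?qR//=.
  rewrite !(mulr0, mul0r, addr0) expi2pi0 scale1r; set w := e _.
  rewrite -2![w *: _]mul_polyC -!scalerA -scalerDr detZ -fX -rmorphXn /w expi2piXn.
  have -> : Q%:R * (a%:~R / q1%:R) = (q2%:Z * a)%:~R :> R.
    by rewrite natrM rmorphM/= [q1%:R * _]mulrC mulrACA mulfV ?qR// mulr1.
  by rewrite expi2pi_int mul1r.
have dq2 n : f`_n != 0 -> (q2 %| n)%N.
  (* Here the gauge transformation fixes the first hop and rotates the second one, exactly as the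
     rotation of ['X] does. *)
  apply: (dvdn_of_invariant q2_gt0 b1); rewrite compE [RHS]fX.
  rewrite [RHS](@hop_pencil_conj _ _ (0, q2%:R^-1) 0 1) ?mulr0 ?mulfV ?qR//=.
  by rewrite !(mulr0, mul0r, addr0, add0r) expi2pi0 !scale1r.
exists f`_0, f`_Q; split.
- rewrite -horner_coef0 -[_.[0]]/(horner_eval 0 f) -det_map_mx.
  have -> : map_mx (horner_eval 0) (map_mx polyC A + 'X *: map_mx polyC B) = A.
    apply/matrixP => i j; rewrite !mxE/= /horner_eval.
    by rewrite !(hornerD, hornerM, hornerX, hornerC) mul0r addr0.
  exact: hop_mx0_det.
- by have := lead_coef_eq0 f; rewrite lead_coefE sf /= => ->; rewrite -size_poly_eq0 sf.
apply/polyP => n; rewrite coefD coefC coefZ coefXn.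
have [->|n0] := eqVneq n 0%N; first by rewrite ltn_eqF ?muln_gt0 ?q1_gt0// mulr0 addr0.
have [->|nQ] := eqVneq n Q; first by rewrite mulr1 add0r.
rewrite mulr0 addr0; apply/eqP/negPn/negP => fn.
have /dvdn_leq : (Q %| n)%N by rewrite Gauss_dvd// dq1// dq2.
rewrite lt0n n0 => /(_ isT); rewrite leq_eqVlt eq_sym (negPf nQ)/= => lt.
by rewrite nth_default ?eqxx ?sf in fn.
Qed.

End Lattice.

(** * Floquet matrices *)

Section Floquet.
Local Open Scope sesquilinear_scope.
Variable R : realType.
Local Notation C := R[i].
Local Notation "x %:C" := (real_complex R x).
Local Notation e := (@expi2pi R).
Variables q1 q2 : nat.
Hypotheses (q1_gt0 : (0 < q1)%N) (q2_gt0 : (0 < q2)%N).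
Local Notation Q := (q1 * q2)%N.
Variable V : int -> int -> R.
Implicit Types (th k : R * R).
Local Notation hop := (@hop_mx R q1 q2).

Local Notation N1 := (@hop_mx R q1 q2 (1, 0) (0, 0)).
Local Notation N2 := (@hop_mx R q1 q2 (0, 1) (0, 0)).

Definition potential_mx : 'M[C]_Q := diag_mx (\row_i (V (site1 i) (site2 i))%:C).

(** The matrix of [DV] at [k = (q1 th1, q2 th2)] in the gauge where momentum enters only through one
    phase per direction of hopping. *)
Definition floquet_mx th : 'M[C]_Q :=
  e th.1 *: N1 + e (- th.1) *: N1^T + e th.2 *: N2 + e (- th.2) *: N2^T + potential_mx.

Lemma DV_hop k : DV q1 q2 V k = hop (1, 0) k + hop (-1, 0) k
  + hop (0, 1) k + hop (0, -1) k + potential_mx.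
Proof.
apply/matrixP => i j; rewrite !mxE; congr (_ + _); last first.
  by case: (i == j); rewrite ?mulr1n ?mulr0n.
by rewrite !big_cons big_nil !addrA; apply: addr0.
Qed.

Lemma DV_conj th : DV q1 q2 V (q1%:R * th.1, q2%:R * th.2) =
  phase_mx q1 q2 th *m floquet_mx th *m phase_mx q1 q2 (- th.1, - th.2).
Proof.
have N1E : hop (-1, 0) (0, 0) = N1^T.
  by rewrite -(hop_mx0N R q1_gt0 q2_gt0 (1, 0)) oppr0.
have N2E : hop (0, -1) (0, 0) = N2^T.
  by rewrite -(hop_mx0N R q1_gt0 q2_gt0 (0, 1)) oppr0.
rewrite DV_hop !hop_mx_conj// /floquet_mx N1E N2E /=.
rewrite !(mul1r, mul0r, addr0, add0r, mulNr) !mulmxDr !mulmxDl -!scalemxAr -!scalemxAl.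
by congr (_ + _); rewrite diag_mxC -mulmxA phase_mxV mulmx1.
Qed.

Lemma adjmx_real_spectrum n (A : 'M[C]_n) : A \is hermsymmx ->
  exists s, sorted_real_spectrum A s.
Proof.
move=> hA; have [P [d [_ _ dP]]] := hermitian_diagonalization hA.
exists (sort <=%R [seq d 0 i | i <- enum 'I_n]); split.
- exact: sort_le_sorted.
- by rewrite size_sort size_map size_enum_ord.
- by apply/dP; rewrite perm_sort.
Qed.

Lemma real_spectrum_sub n (A : 'M[C]_n) s (a : R) : sorted_real_spectrum A s ->
  sorted_real_spectrum (A - a%:C%:M) [seq x - a | x <- s].
Proof.
move=> [srt sz cA]; split; last 1 first.
- have -> : char_poly (A - a%:C%:M) = char_poly A \Po ('X + a%:C%:P).
    rewrite -[_ \Po _]/(comp_poly _ (char_poly A)) -det_map_mx; congr (\det _).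
    apply/matrixP => i j; rewrite !mxE/= comp_polyB rmorphMn/= comp_polyX comp_polyC.
    by rewrite mulrnDl polyCB polyCMn; ring.
  rewrite cA rmorph_prod/= big_map; apply: eq_bigr => x _.
  by rewrite comp_polyB comp_polyX comp_polyC rmorphB polyCB opprB addrA addrAC.
- by rewrite sorted_map; apply: sub_sorted srt => x y /= le; rewrite lerB.
- by rewrite size_map.
Qed.

Lemma N1_adj : N1^t* = N1^T. Proof. exact: hop_mx0_real. Qed.
Lemma N2_adj : N2^t* = N2^T. Proof. exact: hop_mx0_real. Qed.

Lemma potential_mx_herm : potential_mx \is hermsymmx.
Proof.
apply/is_hermitianmxP; rewrite expr0 scale1r; apply/matrixP => i j; rewrite !mxE rmorphMn/=.
have [->|ij] := eqVneq i j; first by rewrite !mulr1n -[Num.conj _]/(conjc _) conjc_real.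
by rewrite !mulr0n.
Qed.

Lemma floquet_mx_herm th : floquet_mx th \is hermsymmx.
Proof.
rewrite /floquet_mx -N1_adj -N2_adj -!addrA addrA.
by apply: twisted_sum_hermitian; rewrite addrA; apply/twisted_sum_hermitian/potential_mx_herm.
Qed.

(** The set from which [xget] picks is inhabited, because [DV] is conjugate to a Hermitian matrix
    with momentum [(k1 / q1, k2 / q2)]. *)
Lemma eigs_spectrum k : sorted_real_spectrum (DV q1 q2 V k) (eigs q1 q2 V k).
Proof.
pose th := (q1%:R^-1 * k.1, q2%:R^-1 * k.2).
have -> : k = (q1%:R * th.1, q2%:R * th.2).
  by rewrite /= !mulVKf ?pnatr_eq0 -?lt0n//; case: k {th}.
have [s [srt sz cA]] := adjmx_real_spectrum (floquet_mx_herm th).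
have : exists s, sorted_real_spectrum (DV q1 q2 V (q1%:R * th.1, q2%:R * th.2)) s.
  by exists s; split => //; rewrite -cA DV_conj char_poly_conj// phase_mxV.
exact: xgetPex.
Qed.

Lemma eigs_floquet th (a : R) : sorted_real_spectrum (floquet_mx th - a%:C%:M)
  [seq x - a | x <- eigs q1 q2 V (q1%:R * th.1, q2%:R * th.2)].
Proof.
apply: real_spectrum_sub; have [srt sz cA] := eigs_spectrum (q1%:R * th.1, q2%:R * th.2).
by split => //; rewrite -cA DV_conj char_poly_conj// phase_mxV.
Qed.

Lemma DVD_int k (m1 m2 : int) : DV q1 q2 V (k.1 + m1%:~R, k.2 + m2%:~R) = DV q1 q2 V k.
Proof. by rewrite !DV_hop !hop_mxD_int. Qed.

Lemma DV_unit_box k : exists2 k', in_unit_box k' & DV q1 q2 V k = DV q1 q2 V k'.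
Proof.
exists (k.1 + (- Num.floor k.1)%:~R, k.2 + (- Num.floor k.2)%:~R); last by rewrite DVD_int.
have box (x : R) : 0 <= x + (- Num.floor x)%:~R < 1.
  rewrite rmorphN/= subr_ge0 ltrBlDl floor_le_tmp/=.
  by have := floorD1_gt x; rewrite intrD.
by split; apply: box.
Qed.

End Floquet.

(** * The Fermi polynomial *)

(** Exchanging the two variables turns the degree in the inner variable into an outer one, to which
    [size_det_leq] applies. *)
Lemma size_coef_det_leq (R : idomainType) n (A : 'M[{poly {poly R}}]_n) d :
  (forall i j k, size ((A i j)`_k)%R <= d.+1)%N ->
  forall k, (size ((\det A)`_k)%R <= (n * d).+1)%N.
Proof.
move=> leA k; apply: (leq_trans (max_size_coefXY _ _)); rewrite sizeYE -det_map_mx.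
apply: size_det_leq => i j; rewrite mxE -sizeYE.
by apply/bigmax_leqP => l _; apply: leA.
Qed.

Lemma size_binomial (F : fieldType) (c0 c1 : F) n : (0 < n)%N -> c1 != 0 ->
  size (c0%:P + c1 *: 'X^n) = n.+1.
Proof.
move=> n0 c10; rewrite addrC size_polyDl size_scale ?size_polyXn//.
by rewrite ltnS (leq_trans (size_polyC_leq1 _)).
Qed.

(** The derivative is a nonzero multiple of a power of ['X], and [0] is not a root of the
    binomial. *)
Lemma coprimep_binomial_deriv (F : numFieldType) (c0 c1 : F) n :
  (0 < n)%N -> c0 != 0 -> c1 != 0 ->
  coprimep (c0%:P + c1 *: 'X^n) (c0%:P + c1 *: 'X^n)^`().
Proof.
move=> n0 c00 c10; rewrite derivD derivC add0r derivZ derivXn -scaler_nat scalerA.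
rewrite coprimepZr ?mulf_neq0 ?pnatr_eq0 -?lt0n//.
rewrite coprimep_expr// coprimepX /root hornerD hornerC hornerZ hornerXn.
by rewrite expr0n gtn_eqF// mulr0 addr0.
Qed.

Lemma comp_Xn_scaleX (F : comNzRingType) (c : F) n : 'X^n \Po (c *: 'X) = c ^+ n *: 'X^n.
Proof. by rewrite comp_Xn_poly exprZn. Qed.

Lemma map_quadratic_horner (F : comNzRingType) (p0 p1 p2 : {poly F}) u :
  map_poly (horner_eval u) (p2%:P * 'X^2 + p1%:P * 'X + p0%:P) =
  p2.[u] *: 'X^2 + p1.[u] *: 'X + p0.[u]%:P.
Proof.
rewrite 2!rmorphD 2!rmorphM/= map_polyXn map_polyX !map_polyC/= /horner_eval.
by rewrite !mul_polyC.
Qed.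

Section Fermi.
Variables (F : numFieldType) (n : nat) (M1 M1' M2 M2' W : 'M[F]_n).

(** A common form for the restrictions of [fermi] to lines [u = const] or [v = const] and for the
    determinants along paths of momenta, so that rescaling a variable relates them. *)
Definition pencil (p1 p2 p3 p4 p5 : {poly F}) : {poly F} :=
  \det (p1 *: map_mx polyC M1 + p2 *: map_mx polyC M1' + p3 *: map_mx polyC M2
        + p4 *: map_mx polyC M2' + p5 *: map_mx polyC W).

Lemma pencil_comp p1 p2 p3 p4 p5 r : pencil p1 p2 p3 p4 p5 \Po r =
  pencil (p1 \Po r) (p2 \Po r) (p3 \Po r) (p4 \Po r) (p5 \Po r).
Proof.
rewrite -[LHS]/(comp_poly r _) -det_map_mx; congr (\det _).
by apply/matrixP => i j; rewrite !mxE/= !comp_polyD !comp_polyM !comp_polyC.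
Qed.

Lemma pencilZ c p1 p2 p3 p4 p5 :
  pencil (c *: p1) (c *: p2) (c *: p3) (c *: p4) (c *: p5) = c ^+ n *: pencil p1 p2 p3 p4 p5.
Proof.
rewrite /pencil -[c ^+ n *: _]mul_polyC rmorphXn -detZ; congr (\det _).
by rewrite !scalerDr !scalerA !mul_polyC.
Qed.

(* The outer variable is [v], the inner one [u]: this is [(u v)^n] times the
   determinant of [x M1 + x^-1 M1' + y M2 + y^-1 M2' + W] at [x = u v], [y = u / v]. *)
Definition fermi : {poly {poly F}} :=
  \det (\matrix_(i, j) ((M1 i j *: 'X^2 + (M2' i j)%:P)%:P * 'X^2 + (W i j *: 'X)%:P * 'X
     + ((M1' i j)%:P + M2 i j *: 'X^2)%:P)).

Lemma fermi_horner_inner u : map_poly (horner_eval u) fermi =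
  pencil (u ^+ 2 *: 'X^2) 1%:P (u ^+ 2)%:P 'X^2 (u *: 'X).
Proof.
rewrite -det_map_mx; congr (\det _); apply/matrixP => i j; rewrite mxE [in LHS]mxE.
rewrite [LHS]map_quadratic_horner !(hornerD, hornerZ, hornerXn, hornerX, hornerC).
by rewrite !mxE -!mul_polyC !(polyCD, polyCM); ring.
Qed.

Lemma fermi_horner_outer v : fermi.[v%:P] =
  pencil (v ^+ 2 *: 'X^2) 1%:P 'X^2 (v ^+ 2)%:P (v *: 'X).
Proof.
rewrite -[LHS]/(horner_eval v%:P fermi) -det_map_mx; congr (\det _).
apply/matrixP => i j; rewrite !mxE/= /horner_eval.
rewrite !(hornerD, hornerM, hornerZ, hornerXn, hornerX, hornerC).
by rewrite -!mul_polyC rmorphXn/=; ring.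
Qed.

Lemma size_fermi : (size fermi <= (2 * n).+1)%N.
Proof.
rewrite mulnC; apply: size_det_leq => i j; rewrite mxE; apply/leq_sizeP => k lt_k.
by rewrite !(coefD, coefCM, coefXn, coefX, coefC) !gtn_eqF ?mulr0 ?addr0// (leq_trans _ lt_k).
Qed.

Lemma size_coef_fermi i : (size (fermi`_i)%R <= (2 * n).+1)%N.
Proof.
rewrite mulnC; apply: size_coef_det_leq => {}i j k; rewrite mxE.
rewrite !(coefD, coefCM, coefXn, coefX, coefC); apply/leq_sizeP => l lt_l.
have coef0l (c : F) : c%:P`_l = 0 by rewrite coefC gtn_eqF// (leq_trans _ lt_l).
have coef1l (c : F) : (c *: 'X)`_l = 0.
  by rewrite coefZ coefX gtn_eqF ?mulr0// (leq_trans _ lt_l).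
have coef2l (c : F) : (c *: 'X^2)`_l = 0.
  by rewrite coefZ coefXn gtn_eqF ?mulr0// (leq_trans _ lt_l).
case: (k == 2) (k == 1) (k == 0)%N => [] [] [];
  by rewrite ?(mulr1, mulr0, addr0, add0r, coefD, coef0, coef0l, coef1l, coef2l).
Qed.

Lemma fermi_inner0 : map_poly (horner_eval 0) fermi =
  (\det (map_mx polyC M1' + 'X *: map_mx polyC M2')) \Po 'X^2.
Proof.
rewrite fermi_horner_inner expr0n/= !scale0r polyC0.
rewrite -[RHS]/(comp_poly _ _) -det_map_mx; congr (\det _).
by apply/matrixP => i j; rewrite !mxE/= comp_polyD comp_polyM comp_polyX !comp_polyC; ring.
Qed.

Lemma fermi_outer0 : fermi`_0 = (\det (map_mx polyC M1' + 'X *: map_mx polyC M2)) \Po 'X^2.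
Proof.
rewrite -horner_coef0 -polyC0 fermi_horner_outer expr0n/= !scale0r polyC0.
rewrite -[RHS]/(comp_poly _ _) -det_map_mx; congr (\det _).
by apply/matrixP => i j; rewrite !mxE/= comp_polyD comp_polyM comp_polyX !comp_polyC; ring.
Qed.

(* Up to the factor [x^n], [F1] and [F2] are [fermi] at [(u, v T)] and [(u T, v)]. *)
Lemma fermi_multiple_point u v x y : x != 0 -> y != 0 ->
  u * v = x -> u ^+ 2 = x * y -> v ^+ 2 = x / y ->
  let F1 := \det ('X^2 *: map_mx polyC (x *: M1 + y^-1 *: M2')
             + map_mx polyC (x^-1 *: M1' + y *: M2) + 'X *: map_mx polyC W) in
  let F2 := \det ('X^2 *: map_mx polyC (x *: M1 + y *: M2)
             + map_mx polyC (x^-1 *: M1' + y^-1 *: M2') + 'X *: map_mx polyC W) in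
  F1.[1] = 0 /\ F1^`().[1] = 0 -> F2.[1] = 0 /\ F2^`().[1] = 0 ->
  [/\ fermi.[v%:P].[u] = 0, fermi^`().[v%:P].[u] = 0 & (swapXY fermi)^`().[u%:P].[v] = 0].
Proof.
move=> x0 y0 uv u2 v2 F1 F2.
have uv0 : u * v != 0 by rewrite uv.
have [u0 v0] : u != 0 /\ v != 0 by apply/andP; rewrite -negb_or -mulf_eq0.
have E1 : map_poly (horner_eval u) fermi \Po (v *: 'X) = x ^+ n *: F1.
  have -> : F1 = pencil (x *: 'X^2) (x^-1)%:P y%:P (y^-1 *: 'X^2) 'X.
    by congr (\det _); apply/matrixP => i j; rewrite !mxE -!mul_polyC !(polyCD, polyCM); ring.
  rewrite fermi_horner_inner pencil_comp -pencilZ !comp_polyZ comp_polyX !comp_polyC comp_Xn_scaleX.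
  by rewrite !scalerA !scale_polyC -exprMn uv expr2 mulfV// v2 u2.
have E2 : fermi.[v%:P] \Po (u *: 'X) = x ^+ n *: F2.
  have -> : F2 = pencil (x *: 'X^2) (x^-1)%:P (y *: 'X^2) (y^-1)%:P 'X.
    by congr (\det _); apply/matrixP => i j; rewrite !mxE -!mul_polyC !(polyCD, polyCM); ring.
  rewrite fermi_horner_outer pencil_comp -pencilZ !comp_polyZ comp_polyX !comp_polyC comp_Xn_scaleX.
  by rewrite !scalerA !scale_polyC -exprMn [v * u]mulrC uv expr2 mulfV// v2 u2.
move=> [F11 F1'] [_ F2'].
have root_scale (p q : {poly F}) c : p \Po (c *: 'X) = x ^+ n *: q -> q.[1] = 0 -> p.[c] = 0.
  move=> /(congr1 (fun r : {poly F} => r.[1])); rewrite horner_comp !hornerZ hornerX mulr1.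
  by move=> -> ->; rewrite mulr0.
have droot_scale (p q : {poly F}) c : c != 0 -> p \Po (c *: 'X) = x ^+ n *: q ->
    q^`().[1] = 0 -> p^`().[c] = 0.
  move=> c0 /(congr1 (fun r : {poly F} => r^`().[1])).
  rewrite deriv_comp derivZ derivX hornerM horner_comp derivZ !hornerZ hornerX hornerC mulr1.
  by move=> + q0; rewrite q0 mulr0 => /eqP; rewrite mulf_eq0 (negPf c0) orbF => /eqP.
split.
- by rewrite -horner2_swapXY horner_swapXY (root_scale _ _ _ E1).
- by rewrite -horner2_swapXY horner_swapXY -deriv_map (droot_scale _ _ _ v0 E1).
rewrite -horner2_swapXY horner_swapXY -deriv_map -horner_swapXY swapXYK.
exact: droot_scale E2 _.
Qed.

Lemma card_fermi_multiple_points (c0 c1 d0 d1 : F) (zs : seq (F * F)) :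
  (0 < n)%N -> c0 != 0 -> c1 != 0 -> d0 != 0 -> d1 != 0 ->
  \det (map_mx polyC M1' + 'X *: map_mx polyC M2') = c0%:P + c1 *: 'X^n ->
  \det (map_mx polyC M1' + 'X *: map_mx polyC M2) = d0%:P + d1 *: 'X^n ->
  uniq zs ->
  (forall z, z \in zs -> [/\ fermi.[z.2%:P].[z.1] = 0, fermi^`().[z.2%:P].[z.1] = 0 &
     (swapXY fermi)^`().[z.1%:P].[z.2] = 0]) ->
  (size zs <= 2 * n * (2 * (2 * n) - 1))%N.
Proof.
move=> n0 c00 c10 d00 d10 E0 E1 uzs zsP; have d0' : (0 < 2 * n)%N by rewrite muln_gt0.
have sq (b0 b1 : F) : (b0%:P + b1 *: 'X^n) \Po 'X^2 = b0%:P + b1 *: 'X^(2 * n).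
  by rewrite comp_polyD comp_polyC comp_polyZ comp_Xn_poly -exprM.
apply: (card_multiple_points d0') uzs zsP.
- exact: size_fermi.
- exact: size_coef_fermi.
- by rewrite fermi_inner0 E0 sq size_binomial.
- by rewrite fermi_inner0 E0 sq coprimep_binomial_deriv.
- by rewrite fermi_outer0 E1 sq coprimep_binomial_deriv.
Qed.

End Fermi.

(** * Two directions through a point of the momentum torus *)

Lemma scaler_twist (K : comNzRingType) (L : lmodType K) (A A' B B' D Z : L) (s s' x x' y y' : K) :
  s *: (x *: A + y *: B) + s' *: (x' *: A' + y' *: B') + (D - Z) =
  (x * s) *: A + (x' * s') *: A' + (y * s) *: B + (y' * s') *: B' + D - Z.
Proof.
rewrite !scalerDr !scalerA ![s * _]mulrC ![s' * _]mulrC -[RHS]addrA; congr (_ + _).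
by rewrite addrACA addrA.
Qed.

Lemma scaler_twist_swap (K : comNzRingType) (L : lmodType K) (A A' B B' D Z : L)
    (s s' x x' y y' : K) :
  s *: (x *: A + y *: B) + s' *: (x' *: A' + y' *: B') + (D - Z) =
  (x * s) *: A + (x' * s') *: A' + (y' * s') *: B' + (y * s) *: B + D - Z.
Proof. by rewrite scaler_twist -!addrA; do 2 congr (_ + _); rewrite addrCA. Qed.

Section Twist.
Local Open Scope sesquilinear_scope.
Variables (R : realType) (n : nat).
Local Notation C := R[i].
Local Notation e := (@expi2pi R).
Implicit Types A B D Z W : 'M[C]_n.

Lemma adjmx_twist A B (x y : R) :
  (e x *: A + e y *: B)^t* = e (- x) *: A^t* + e (- y) *: B^t*.
Proof. by apply/matrixP => i j; rewrite !mxE rmorphD !rmorphM/= -!expi2piN. Qed.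

(** Both phases are multiplied by [e h]; for [x = u v] and [y = u / v] this moves [u] and fixes
    [v]. *)
Lemma twist_path A B D Z (x y h : R) :
  e h *: (e x *: A + e y *: B) + e (- h) *: (e x *: A + e y *: B)^t* + (D - Z) =
  e (x + h) *: A + e (- (x + h)) *: A^t* + e (y + h) *: B + e (- (y + h)) *: B^t* + D - Z.
Proof. by rewrite adjmx_twist !opprD !expi2piD; apply: scaler_twist. Qed.

(** The phases are multiplied by [e h] and [e (- h)], which moves [v] and fixes [u]. *)
Lemma twist_path_adj A B D Z (x y h : R) :
  e h *: (e x *: A + e (- y) *: B^t*) + e (- h) *: (e x *: A + e (- y) *: B^t*)^t* + (D - Z) =
  e (x + h) *: A + e (- (x + h)) *: A^t* + e (y - h) *: B + e (- (y - h)) *: B^t* + D - Z.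
Proof.
by rewrite adjmx_twist trmxCK !opprD !opprK !expi2piD; apply: scaler_twist_swap.
Qed.

Lemma fermi_twist_multiple_point A B W (x y : R) (u v : C) :
  u * v = e x -> u = v * e y ->
  let F M := \det ('X^2 *: map_mx polyC M + map_mx polyC (M^t* ) + 'X *: map_mx polyC W) in
  let P := fermi A (A^t* ) B (B^t* ) W in
  (F (e x *: A + e (- y) *: B^t*)).[1] = 0 /\ (F (e x *: A + e (- y) *: B^t*))^`().[1] = 0 ->
  (F (e x *: A + e y *: B)).[1] = 0 /\ (F (e x *: A + e y *: B))^`().[1] = 0 ->
  [/\ P.[v%:P].[u] = 0, P^`().[v%:P].[u] = 0 & (swapXY P)^`().[u%:P].[v] = 0].
Proof.
move=> uv uE F P; rewrite /F !adjmx_twist trmxCK opprK -!expi2piV => F1 F2.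
apply: (fermi_multiple_point (expi2pi_neq0 x) (expi2pi_neq0 y)) F1 F2 => //.
  by rewrite expr2 {2}uE mulrA uv.
by rewrite -uv uE mulrAC mulfK ?expi2pi_neq0// expr2.
Qed.

End Twist.

(** * Level points as multiple points of the Fermi curve *)

Section Main.
Local Open Scope sesquilinear_scope.
Variable R : realType.
Local Notation C := R[i].
Local Notation "x %:C" := (real_complex R x).
Local Notation e := (@expi2pi R).
Variables q1 q2 : nat.
Hypotheses (q1_gt0 : (0 < q1)%N) (q2_gt0 : (0 < q2)%N) (cop : coprime q1 q2).
Local Notation Q := (q1 * q2)%N.
Variables (V : int -> int -> R) (m : nat) (a : R).
Hypothesis m_bounds : (0 < m <= Q)%N.
Hypothesis edge : (forall k, in_unit_box k -> lambda q1 q2 V m k <= a) \/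
   (forall k, in_unit_box k -> a <= lambda q1 q2 V m k).
Implicit Types (th k : R * R).
Local Notation N1 := (@hop_mx R q1 q2 (1, 0) (0, 0)).
Local Notation N2 := (@hop_mx R q1 q2 (0, 1) (0, 0)).
Local Notation W := (potential_mx q1 q2 V - a%:C%:M).
Local Notation P := (fermi N1 (N1^t* ) N2 (N2^t* ) W).

(** Periodicity in [k] extends extremality to the plane, since the paths through a level point may
    leave the unit box. *)
Lemma edge_everywhere :
  (forall k, lambda q1 q2 V m k <= a) \/ (forall k, a <= lambda q1 q2 V m k).
Proof.
by case: edge => edge'; [left|right] => k; have [k' /edge' le E] := DV_unit_box q1 q2 V k;
  rewrite /lambda /eigs E.
Qed.

Lemma band_edge_path (B : 'M[C]_Q) (th : R -> R * R) :
  (forall h, e h *: B + e (- h) *: B^t* + W = floquet_mx q1 q2 V (th h) - a%:C%:M) ->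
  lambda q1 q2 V m (q1%:R * (th 0).1, q2%:R * (th 0).2) = a ->
  let F := \det ('X^2 *: map_mx polyC B + map_mx polyC (B^t* ) + 'X *: map_mx polyC W) in
  F.[1] = 0 /\ F^`().[1] = 0.
Proof.
move=> BE l0.
pose s h := [seq x - a | x <- eigs q1 q2 V (q1%:R * (th h).1, q2%:R * (th h).2)].
have sE h : (s h)`_m.-1 = lambda q1 q2 V m (q1%:R * (th h).1, q2%:R * (th h).2) - a.
  have [_ sz _] := eigs_spectrum q1_gt0 q2_gt0 V (q1%:R * (th h).1, q2%:R * (th h).2).
  (* The index has to be in range, because the default value [0] is not shifted by [a]. *)
  by rewrite (nth_map 0) ?sz// prednK//; case/andP: m_bounds.
apply: (@band_edge_double_root _ _ B W s m) => //.
- have -> : W = potential_mx q1 q2 (fun n1 n2 => V n1 n2 - a).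
    by apply/matrixP => i j; rewrite !mxE rmorphB mulrnBl.
  exact: potential_mx_herm.
- by move=> h; rewrite BE; apply: eigs_floquet.
- by rewrite sE l0 subrr.
by case: edge_everywhere => le; [left|right] => h; rewrite sE ?subr_le0 ?subr_ge0.
Qed.

Lemma fermi_level_point k th u v : u * v = e th.1 -> u = v * e th.2 ->
  k = (q1%:R * th.1, q2%:R * th.2) -> lambda q1 q2 V m k = a ->
  [/\ P.[v%:P].[u] = 0, P^`().[v%:P].[u] = 0 & (swapXY P)^`().[u%:P].[v] = 0].
Proof.
move=> uv uE -> lth.
have floquetE t : floquet_mx q1 q2 V t = e t.1 *: N1 + e (- t.1) *: N1^t* + e t.2 *: N2
    + e (- t.2) *: N2^t* + potential_mx q1 q2 V by rewrite N1_adj N2_adj.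
apply: (fermi_twist_multiple_point uv uE).
  apply: (band_edge_path (th := fun h => (th.1 + h, th.2 - h))) => [h|].
    by rewrite floquetE; apply: twist_path_adj.
  by rewrite /= addr0 subr0.
apply: (band_edge_path (th := fun h => (th.1 + h, th.2 + h))) => [h|].
  by rewrite floquetE; apply: twist_path.
by rewrite /= !addr0.
Qed.

(** At [u = 0] only the hops [(-1, 0)] and [(0, -1)] survive, at [v = 0] only [(-1, 0)] and
    [(0, 1)]; both pencils are binomials by coprimality of the periods. *)
Lemma card_floquet_multiple_points (zs : seq (C * C)) : uniq zs ->
  (forall z, z \in zs -> [/\ P.[z.2%:P].[z.1] = 0, P^`().[z.2%:P].[z.1] = 0 &
     (swapXY P)^`().[z.1%:P].[z.2] = 0]) ->
  (size zs <= 2 * Q * (2 * (2 * Q) - 1))%N.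
Proof.
have N1E : @hop_mx R q1 q2 (-1, 0) (0, 0) = N1^t*.
  by rewrite N1_adj -(hop_mx0N R q1_gt0 q2_gt0 (1, 0)) oppr0.
have N2E : @hop_mx R q1 q2 (0, -1) (0, 0) = N2^t*.
  by rewrite N2_adj -(hop_mx0N R q1_gt0 q2_gt0 (0, 1)) oppr0.
have [c0 [c1 [c00 c10]]] := det_hop_pencil R q1_gt0 q2_gt0 cop
  (isT : is_unit_step (-1)) (isT : is_unit_step (-1)).
have [d0 [d1 [d00 d10]]] := det_hop_pencil R q1_gt0 q2_gt0 cop
  (isT : is_unit_step (-1)) (isT : is_unit_step 1).
rewrite N1E N2E => E1 E0; apply: card_fermi_multiple_points E0 E1 => //.
by rewrite muln_gt0 q1_gt0.
Qed.

End Main.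

(** * Level-set points *)

Section Cover.
Variable R : realType.
Local Notation C := R[i].
Local Notation e := (@expi2pi R).

Lemma nat_frac_inj (x y : R) (a b : nat) : 0 <= x < 1 -> 0 <= y < 1 ->
  x + a%:R = y + b%:R -> x = y /\ a = b.
Proof.
move=> /andP[x0 x1] /andP[y0 y1] E.
have ab : a = b.
  case: (ltngtP a b) => // lt; exfalso.
    have : a.+1%:R <= b%:R :> R by rewrite ler_nat.
    by rewrite -natr1; lra.
  have : b.+1%:R <= a%:R :> R by rewrite ler_nat.
  by rewrite -natr1; lra.
by split => //; apply: (addIr a%:R); rewrite E ab.
Qed.

Lemma expi2pi_inj (x y : R) : 0 <= x < 1 -> 0 <= y < 1 -> e x = e y -> x = y.
Proof.
move=> /andP[x0 x1] /andP[y0 y1] E; apply/eqP; rewrite -subr_eq0; apply/eqP/expi2pi_eq1.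
  by apply/andP; split; lra.
by rewrite expi2piD E -expi2piV mulfV ?expi2pi_neq0.
Qed.

(* The [2 q1 q2] preimages of [(e k1, e k2)] under
   [(u, v) -> ((u v)^q1, (u / v)^q2)]. *)
Definition cover_point q1 q2 (k : R * R) (t : 'I_q1 * 'I_q2 * bool) : C * C :=
  let th1 := (k.1 + t.1.1%:R) / q1%:R in let th2 := (k.2 + t.1.2%:R) / q2%:R in
  (e ((th1 + th2 + (t.2 : nat)%:R) / 2), e ((th1 - th2 + (t.2 : nat)%:R) / 2)).

Lemma cover_point_mul q1 q2 k (t : 'I_q1 * 'I_q2 * bool) :
  (cover_point k t).1 * (cover_point k t).2 = e ((k.1 + t.1.1%:R) / q1%:R).
Proof.
rewrite /cover_point /= -expi2piD; move: (_ / q1%:R) (_ / q2%:R) => th1 th2.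
have -> : (th1 + th2 + (t.2 : nat)%:R) / 2 + (th1 - th2 + (t.2 : nat)%:R) / 2 =
    th1 + (t.2 : nat)%:Z%:~R.
  by rewrite -pmulrn; move: (_%:R) => b; lra.
by rewrite expi2piD expi2pi_int mulr1.
Qed.

Lemma cover_point_div q1 q2 k (t : 'I_q1 * 'I_q2 * bool) :
  (cover_point k t).1 = (cover_point k t).2 * e ((k.2 + t.1.2%:R) / q2%:R).
Proof.
rewrite /cover_point /= -expi2piD; move: (_ / q1%:R) (_ / q2%:R) => th1 th2.
by congr e; lra.
Qed.

(** The product and the quotient of the coordinates determine the two momenta, which lie in
    [[0, 1)]; scaled by the periods, they split into [k] and an integer part. The remaining bit is
    the common sign of the coordinates. *)
Lemma cover_point_inj q1 q2 k k' (t t' : 'I_q1 * 'I_q2 * bool) :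
  in_unit_box k -> in_unit_box k' -> cover_point k t = cover_point k' t' -> k = k' /\ t = t'.
Proof.
move=> [k1 k2] [k1' k2'] E.
have qN (q : nat) (a : 'I_q) : 0 < q%:R :> R by rewrite ltr0n (leq_ltn_trans _ (ltn_ord a)).
have in01 (q : nat) (x : R) (a : 'I_q) : 0 <= x < 1 -> 0 <= (x + a%:R) / q%:R < 1.
  move=> /andP[x0 x1]; have q0 := qN _ a.
  rewrite divr_ge0 ?addr_ge0// ?(ltW q0)//= ltr_pdivrMr// mul1r.
  have : a.+1%:R <= q%:R :> R by rewrite ler_nat.
  by rewrite -natr1; lra.
have unfrac (q : nat) (x y : R) (a b : 'I_q) : 0 <= x < 1 -> 0 <= y < 1 ->
    (x + a%:R) / q%:R = (y + b%:R) / q%:R -> x = y /\ a = b.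
  move=> x01 y01 /(mulIf _) E'.
  have [] := nat_frac_inj x01 y01 (E' _); first by rewrite invr_neq0// gt_eqF// (qN _ a).
  by move=> -> /val_inj->.
have th1 : (k.1 + t.1.1%:R) / q1%:R = (k'.1 + t'.1.1%:R) / q1%:R.
  by apply: expi2pi_inj; rewrite ?in01// -!cover_point_mul E.
have th2 : (k.2 + t.1.2%:R) / q2%:R = (k'.2 + t'.1.2%:R) / q2%:R.
  apply: expi2pi_inj; rewrite ?in01//.
  apply: (mulfI (expi2pi_neq0 _ : (cover_point k t).2 != 0)).
  by rewrite -cover_point_div E -cover_point_div.
have c : t.2 = t'.2.
  have := congr1 fst E; rewrite /cover_point /= th1 th2.
  rewrite ![(_ + _ + (_ : nat)%:R) / 2]mulrDl !expi2piD => /(mulfI (expi2pi_neq0 _)).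
  have half (b : bool) : 0 <= ((b : nat)%:R / 2 : R) < 1.
    apply/andP; split; first by rewrite divr_ge0.
    by rewrite ltr_pdivrMr// mul1r ltr_nat; case: b.
  move=> /(expi2pi_inj (half _) (half _)).
  move=> /(mulIf (invr_neq0 (lt0r_neq0 (ltr0Sn R 1)))) /eqP; rewrite eqr_nat.
  by case: (t.2) (t'.2) => [] [].
have [[E1 a1] [E2 a2]] := (unfrac _ _ _ _ _ k1 k1' th1, unfrac _ _ _ _ _ k2 k2' th2).
split; first by move: E1 E2; clear; case: k k' => ? ? [? ?] /= -> ->.
by move: a1 a2 c; clear; case: t t' => [[a b] c] [[a' b'] c'] /= -> -> ->.
Qed.
End Cover.

Unset Implicit Arguments.
Set Strict Implicit.
Set Printing Implicit Defensive.

Theorem theorem4p1 (R : realType) (q1 q2 : nat) (V : int -> int -> R)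
  (m : nat) (lstar : R) :
  (0 < q1)%N -> (0 < q2)%N -> coprime q1 q2 ->
  is_q_periodic q1 q2 V ->
  (1 <= m <= q1 * q2)%N ->
  (* lstar is the maximum or the minimum value of lambda_m over [0,1)^2 *)
  (exists2 k0, in_unit_box k0 & lambda q1 q2 V m k0 = lstar) ->
  ((forall k, in_unit_box k -> lambda q1 q2 V m k <= lstar) \/
   (forall k, in_unit_box k -> lstar <= lambda q1 q2 V m k)) ->
  (* the level set has at most 4 q1 q2 elements *)
  forall ks : seq (R * R), uniq ks ->
    (forall k, k \in ks -> in_unit_box k /\ lambda q1 q2 V m k = lstar) ->
    (size ks <= 4 * q1 * q2)%N.
Proof.
move=> q1_gt0 q2_gt0 cop _ m_bounds _ edge ks uks ksP.
pose zs := [seq cover_point k t | k <- ks, t <- enum {: 'I_q1 * 'I_q2 * bool}].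
have uzs : uniq zs.
  apply: allpairs_uniq => //; first exact: enum_uniq.
  move=> _ _ /allpairsP[[k t] [/= kks _ ->]] /allpairsP[[k' t'] [/= kks' _ ->]] /=.
  by case/(cover_point_inj (ksP _ kks).1 (ksP _ kks').1) => -> ->.
have le : (size zs <= 2 * (q1 * q2) * (2 * (2 * (q1 * q2)) - 1))%N.
  apply: (card_floquet_multiple_points q1_gt0 q2_gt0 cop (V := V) (a := lstar) uzs).
  move=> z /allpairsP[[k t] [/= /ksP[kbox lk] _ ->]].
  have mulK (q : nat) (x : R) : (0 < q)%N -> x = q%:R * (x / q%:R).
    by move=> q0; rewrite mulrC divfK// pnatr_eq0 -lt0n.
  (* The momenta of the lift belong to [k] translated by an integer vector, where [DV] is the same
     matrix. *)
  apply: (fermi_level_point q1_gt0 q2_gt0 m_bounds edge (cover_point_mul k t)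
    (cover_point_div k t) (k := (k.1 + t.1.1%:R, k.2 + t.1.2%:R))
    (th := ((k.1 + t.1.1%:R) / q1%:R, (k.2 + t.1.2%:R) / q2%:R))).
    by apply: (f_equal2 pair); apply: mulK.
  by rewrite -lk /lambda /eigs (DVD_int q1 q2 V k t.1.1%:Z t.1.2%:Z).
move: le; have -> : size zs = (size ks * (q1 * q2 * 2))%N.
  by rewrite size_allpairs -cardE !card_prod !card_ord card_bool.
have : (0 < q1 * q2)%N by rewrite muln_gt0 q1_gt0.
(* Each level point has [2 Q] lifts; cancelling this factor leaves [4 Q - 1], which is below
   [4 Q]. *)
rewrite -[(4 * q1 * q2)%N]mulnA; move: (q1 * q2)%N => Q Q0 le.
rewrite -(leq_pmul2r (_ : 0 < Q * 2)%N) ?muln_gt0 ?Q0// (leq_trans le)//.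
by rewrite [leqRHS]mulnC leq_mul//; lia.
Qed.
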